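(* Let $n\ge 1$ and let $\equiv$ be any lattice congruence of the weak order on $S_n$. Let $R_n\subseteq S_n$ be the set defined recursively below. Then $R_n$ contains exactly one permutation from each equivalence class of $\equiv$, and $R_n$ is a zigzag language. Moreover, Algorithm J run on $L_n:=R_n$ with initial permutation $\pi_0=\mathrm{id}_n$ visits every permutation of $R_n$ exactly once, say in the order $\pi_1,\pi_2,\ldots$, and the sequence of classes $X(\pi_1),X(\pi_2),\ldots$ is a Hamilton path in the cover graph of the lattice quotient $S_n/{\equiv}$: any two consecutive classes form a cover relation in $S_n/{\equiv}$. In particular, the cover graph of $S_n/{\equiv}$ has a Hamilton path.
   Context: $S_n$ is the set of permutations of $[n]=\{1,\dots,n\}$ in one-line notation $\pi=a_1\cdots a_n$. The inversion set of $\pi$ is $\mathrm{inv}(\pi)=\{(a_i,a_j): i<j,\ a_i>a_j\}$. The weak order on $S_n$ is defined by $\pi\le\rho$ iff $\mathrm{inv}(\pi)\subseteq\mathrm{inv}(\rho)$. It is a lattice, and its cover relations are exactly the pairs of permutations that differ by swapping two entries at adjacent positions. A lattice congruence is an equivalence relation $\equiv$ on $S_n$ such that $\pi\equiv\pi'$ and $\rho\equiv\rho'$ imply $\pi\vee\rho\equiv\pi'\vee\rho'$ and $\pi\wedge\rho\equiv\pi'\wedge\rho'$. The lattice quotient $S_n/{\equiv}$ is the set of equivalence classes, ordered by $X<Y$ iff $x<y$ for some $x\in X$, $y\in Y$. Its cover graph is the graph of its cover relations. For $\pi\in S_n$, $X(\pi)$ denotes the class of $\pi$. Notation. $\mathrm{id}_n=12\cdots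 n$, and $\varepsilon$ is the empty permutation. For $\pi\in S_{n-1}$ and $1\le i\le n$, $c_i(\pi)\in S_n$ is obtained by inserting the value $n$ at position $i$ of $\pi$. For $\pi\in S_n$, $p(\pi)\in S_{n-1}$ is obtained by deleting the value $n$. Restriction. The restriction $\equiv^*$ of $\equiv$ is the relation on $S_{n-1}$ given by $\pi\equiv^*\rho$ iff $c_n(\pi)\equiv c_n(\rho)$. It is a lattice congruence of the weak order on $S_{n-1}$. Definition of $R_n$. Set $R_0=\{\varepsilon\}$. For $n\ge1$, let $R_{n-1}$ be the set constructed recursively for $\equiv^*$. - If $\mathrm{id}_n\not\equiv c_{n-1}(\mathrm{id}_{n-1})$: for each $\pi\in R_{n-1}$, let $R_\pi$ contain exactly one element of $X\cap\{c_1(\pi),\dots,c_n(\pi)\}$ for every class $X$ meeting this set, chosen so that $c_1(\pi),c_n(\pi)\in R_\pi$ (these lie in distinct classes). Set $R_n=\bigcup_{\pi\in R_{n-1}}R_\pi$. - Otherwise, set $R_n=\{c_n(\pi):\pi\in R_{n-1}\}$. Zigzag language. $L_n\subseteq S_n$ is a zigzag language if either $n=0$ and $L_0=\{\varepsilon\}$, or $n\ge1$, $L_{n-1}:=\{p(\pi):\pi\in L_n\}$ is a zigzag language, and one of the following holds: - (z1) $c_1(\pi),c_n(\pi)\in L_n$ for all $\pi\in L_{n-1}$; - (z2) $L_n=\{c_n(\pi):\pi\in L_{n-1}\}$. Jumps. Given a substring $a_i\cdots a_j$ of a permutation with $a_i>a_{i+1},\dots,a_j$, a right jump of the value $a_i$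 by $j-i$ steps replaces this substring by $a_{i+1}\cdots a_ja_i$. Given a substring with $a_j>a_i,\dots,a_{j-1}$, a left jump of $a_j$ by $j-i$ steps replaces it by $a_ja_i\cdots a_{j-1}$. A jump is minimal with respect to $L_n$ if it produces a permutation in $L_n$ and every jump of the same value in the same direction by fewer steps produces a permutation not in $L_n$. Algorithm J (input $L_n$ and $\pi_0\in L_n$). Visit $\pi_0$. Then repeat the following step: - In the most recently visited permutation, consider the values $n,n-1,\dots,2$ in this order, and take the first value admitting a minimal jump that produces a not-yet-visited permutation of $L_n$. - If this value admits such jumps in both directions, terminate. Otherwise perform the jump and visit the resulting permutation. - If no value admits such a jump, terminate. *)

(* Defs.v *)
From mathcomp Require Import all_boot.
Set Implicit Arguments. Unset Strict Implicit. Unset Printing Implicit Defensive.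

Definition is_perm (n : nat) (s : seq nat) : Prop := perm_eq s (iota 1 n).

Definition idp (n : nat) : seq nat := iota 1 n.

(* c_i(pi): insert the value (size pi).+1 at position i (1-indexed) *)
Definition ins (i : nat) (pi : seq nat) : seq nat :=
  take i.-1 pi ++ (size pi).+1 :: drop i.-1 pi.

Definition del (pi : seq nat) : seq nat := filter (fun x => x != size pi) pi.

Definition inversion (s : seq nat) (a b : nat) : Prop :=
  exists i j, i < j /\ j < size s /\ nth 0 s i = a /\ nth 0 s j = b /\ b < a.

Definition wle (s t : seq nat) : Prop :=
  forall a b, inversion s a b -> inversion t a b.

Definition is_join (n : nat) (x y j : seq nat) : Prop :=
  [/\ is_perm n j, wle x j, wle y j &
      forall z, is_perm n z -> wle x z -> wle y z -> wle j z].

Definition is_meet (n : nat) (x y m : seq nat) : Prop :=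
  [/\ is_perm n m, wle m x, wle m y &
      forall z, is_perm n z -> wle z x -> wle z y -> wle z m].

(* e is a lattice congruence of the weak order on S_n
   (only its behaviour on S_n matters) *)
Definition lattice_congruence (n : nat) (e : seq nat -> seq nat -> Prop) : Prop :=
  [/\ (forall x, is_perm n x -> e x x),
      (forall x y, is_perm n x -> is_perm n y -> e x y -> e y x),
      (forall x y z, is_perm n x -> is_perm n y -> is_perm n z ->
          e x y -> e y z -> e x z),
      (forall x x' y y' j j', is_perm n x -> is_perm n x' -> is_perm n y ->
          is_perm n y' -> e x x' -> e y y' -> is_join n x y j ->
          is_join n x' y' j' -> e j j') &
      (forall x x' y y' m m', is_perm n x -> is_perm n x' -> is_perm n y ->
          is_perm n y' -> e x x' -> e y y' -> is_meet n x y m ->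
          is_meet n x' y' m' -> e m m')].

Definition restr (e : seq nat -> seq nat -> Prop) : seq nat -> seq nat -> Prop :=
  fun pi rho => e (ins (size pi).+1 pi) (ins (size rho).+1 rho).

(* isR n e R : R is (one of the possible outcomes of) the recursive
   construction R_n for the congruence e on S_n. *)
Fixpoint isR (n : nat) (e : seq nat -> seq nat -> Prop) (R : seq nat -> Prop) : Prop :=
  match n with
  | 0 => forall s, R s <-> s = [::]
  | n'.+1 =>
      exists R' : seq nat -> Prop, isR n' (restr e) R' /\
      ( ( ~ e (idp n'.+1) (ins n' (idp n')) /\
          exists F : seq nat -> seq nat -> Prop,
            (forall pi, R' pi ->
               [/\ F pi (ins 1 pi), F pi (ins n'.+1 pi),
                   (forall s, F pi s -> exists i, [/\ 1 <= i, i <= n'.+1 & s = ins i pi]) &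
                   (forall i, 1 <= i -> i <= n'.+1 ->
                      exists! j, [/\ 1 <= j, j <= n'.+1, F pi (ins j pi) &
                                     e (ins i pi) (ins j pi)])]) /\
            (forall s, R s <-> exists pi, R' pi /\ F pi s))
        \/
        ( e (idp n'.+1) (ins n' (idp n')) /\
          forall s, R s <-> exists pi, R' pi /\ s = ins n'.+1 pi ) )
  end.

Fixpoint zigzag (n : nat) (L : seq nat -> Prop) : Prop :=
  match n with
  | 0 => forall s, L s <-> s = [::]
  | n'.+1 =>
      let L' := fun s => exists t, L t /\ del t = s in
      [/\ (forall s, L s -> is_perm n'.+1 s),
          zigzag n' L' &
          (forall pi, L' pi -> L (ins 1 pi) /\ L (ins n'.+1 pi))
          \/ (forall s, L s <-> exists pi, L' pi /\ s = ins n'.+1 pi)]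
  end.

(* Jumps of the value v in s by d steps (positions are 0-indexed here). *)
Definition rjump_ok (s : seq nat) (v d : nat) : Prop :=
  v \in s /\ index v s + d < size s /\
  forall k, 1 <= k -> k <= d -> nth 0 s (index v s + k) < v.

Definition rjump (s : seq nat) (v d : nat) : seq nat :=
  let i := index v s in
  take i s ++ take d (drop i.+1 s) ++ v :: drop (i + d).+1 s.

Definition ljump_ok (s : seq nat) (v d : nat) : Prop :=
  v \in s /\ d <= index v s /\
  forall k, 1 <= k -> k <= d -> nth 0 s (index v s - k) < v.

Definition ljump (s : seq nat) (v d : nat) : seq nat :=
  let i := index v s in
  take (i - d) s ++ v :: take d (drop (i - d) s) ++ drop i.+1 s.

Definition min_rjump (L : seq nat -> Prop) (s : seq nat) (v : nat) (t : seq nat) : Prop :=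
  exists d, [/\ 0 < d, rjump_ok s v d, t = rjump s v d, L t &
             forall d', 0 < d' -> d' < d -> ~ L (rjump s v d')].

Definition min_ljump (L : seq nat -> Prop) (s : seq nat) (v : nat) (t : seq nat) : Prop :=
  exists d, [/\ 0 < d, ljump_ok s v d, t = ljump s v d, L t &
             forall d', 0 < d' -> d' < d -> ~ L (ljump s v d')].

Definition has_cand (L : seq nat -> Prop) (visited : seq (seq nat)) (s : seq nat) (v : nat) : Prop :=
  exists t, (min_rjump L s v t \/ min_ljump L s v t) /\ t \notin visited.

Definition J_next (L : seq nat -> Prop) (n : nat) (visited : seq (seq nat))
  (s t : seq nat) : Prop :=
  exists v, [/\ 2 <= v, v <= n,
    (forall w, v < w -> w <= n -> ~ has_cand L visited s w),
    (min_rjump L s v t \/ min_ljump L s v t) /\ t \notin visited &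
    ~ (exists tr tl, [/\ min_rjump L s v tr, tr \notin visited,
                         min_ljump L s v tl & tl \notin visited])].

Definition J_run (L : seq nat -> Prop) (n : nat) (pi0 : seq nat) (run : seq (seq nat)) : Prop :=
  [/\ head [::] run = pi0, 0 < size run,
      (forall j, j.+1 < size run ->
          J_next L n (take j.+1 run) (nth [::] run j) (nth [::] run j.+1)) &
      ~ (exists t, J_next L n run (last [::] run) t)].

(* order on the lattice quotient S_n/e, on classes X(pi), X(rho) *)
Definition qlt (n : nat) (e : seq nat -> seq nat -> Prop) (pi rho : seq nat) : Prop :=
  ~ e pi rho /\
  exists x y, [/\ is_perm n x, is_perm n y, e x pi, e y rho & wle x y].

Definition qcover (n : nat) (e : seq nat -> seq nat -> Prop) (pi rho : seq nat) : Prop :=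
  qlt n e pi rho /\ ~ (exists z, [/\ is_perm n z, qlt n e pi z & qlt n e z rho]).

Definition qedge (n : nat) (e : seq nat -> seq nat -> Prop) (pi rho : seq nat) : Prop :=
  qcover n e pi rho \/ qcover n e rho pi.

(* Main.v *)
Require Import Defs.
From mathcomp Require Import all_boot zify.
From mathcomp Require Import boolp.
Set Implicit Arguments. Unset Strict Implicit. Unset Printing Implicit Defensive.

(** The fibre of p over S_n is the chain c_n(p) < ... < c_1(p), and for p <= q
    the join c_i(p) \/ c_n(q) and the meet c_i(q) /\ c_1(p) again lie in the
    fibres of q and of p.  Hence equivalent permutations of S_(n-1) have fibres
    meeting the same classes, while inequivalent ones have fibres meeting no
    common class; so representatives can be chosen fibre by fibre.

    The run for n is obtained from the run for n-1 by replacing each p with the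
    chosen part of its fibre, traversed alternately downwards and upwards.
    Inside a fibre only the largest value jumps; between two fibres that value
    sits at an end of the permutation, where it does not interfere with the
    jumps of the smaller values, so the step of the run for n-1 is copied.

    For the cover relations the induction carries a more flexible property than
    being a cover in the quotient: the two classes are distinct and contain
    elements whose inversion sets differ by at most one pair.  It passes to
    c_1(p), c_1(q) and to c_n(p), c_n(q).  It implies a cover: a class strictly
    between would, after a join and a meet, have an element strictly between the
    two permutations. *)

(* The paper's c_(k+1): positions are counted from 0 below. *)
Local Notation c k p := (ins k.+1 p).

(** * The weak order along the fibres of deletion *)

Lemma is_perm_size n s : is_perm n s -> size s = n.
Proof. by move=> /perm_size ->; rewrite size_iota. Qed.

Lemma is_perm_uniq n s : is_perm n s -> uniq s.
Proof. by move=> /perm_uniq ->; rewrite iota_uniq. Qed.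

Lemma is_perm_mem n s x : is_perm n s -> (x \in s) = (0 < x <= n).
Proof. by move=> /perm_mem ->; rewrite mem_iota add1n ltnS. Qed.

Lemma index_perm_ltn n s x : is_perm n s -> 0 < x -> x <= n -> index x s < n.
Proof.
by move=> sn x0 xn; rewrite -(is_perm_size sn) index_mem (is_perm_mem x sn) x0.
Qed.

Lemma is_perm_nth n s i :
  is_perm n s -> i < n -> [/\ 0 < nth 0 s i, nth 0 s i <= n & index (nth 0 s i) s = i].
Proof.
move=> sn i_n; have iz : i < size s by rewrite (is_perm_size sn).
have := mem_nth 0 iz; rewrite (is_perm_mem _ sn) => /andP[-> ->].
by rewrite index_uniq // (is_perm_uniq sn).
Qed.

Lemma index_inj_perm n s a b : is_perm n s -> 0 < a -> a <= n ->
  index a s = index b s -> a = b.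
Proof.
move=> sn a0 an e; have am : a \in s by rewrite (is_perm_mem _ sn) a0.
by rewrite -(nth_index 0 am) e nth_index // -index_mem -e index_mem.
Qed.

(** Inversions become comparisons of positions of values, so that arguments about the weak order
    reduce to linear arithmetic on [index]. *)
Lemma inversionP n s a b : is_perm n s ->
  inversion s a b <-> [/\ 0 < b, b < a, a <= n & index a s < index b s].
Proof.
move=> sn; split.
  move=> [i [j [ij [js [ia [jb ba]]]]]].
  move: js; rewrite (is_perm_size sn) => jn.
  have [? ? ej] := is_perm_nth sn jn.
  have [? ? ei] := is_perm_nth sn (ltn_trans ij jn).
  by subst a b; rewrite ei ej; split.
move=> [b0 ba an iab]; exists (index a s), (index b s).
have bs : b \in s by rewrite (is_perm_mem _ sn) b0 (leq_trans (ltnW ba)).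
by rewrite index_mem !nth_index // (is_perm_mem _ sn) an (leq_trans b0 (ltnW ba)).
Qed.

Lemma wleP n s t : is_perm n s -> is_perm n t ->
  wle s t <-> forall a b, 0 < b -> b < a -> a <= n ->
              index a s < index b s -> index a t < index b t.
Proof.
move=> sn tn; split=> H a b.
  by move=> b0 ba an iab; have /(inversionP _ _ tn)[]: inversion t a b
    by apply: H; apply/(inversionP _ _ sn).
by move=> /(inversionP _ _ sn)[? ? ? ?]; apply/(inversionP _ _ tn); split=> //; apply: H.
Qed.

Lemma wle_trans s t u : wle s t -> wle t u -> wle s u.
Proof. by move=> st tu a b /st/tu. Qed.

Lemma is_perm0 s : is_perm 0 s <-> s = [::].
Proof.
split; last by move=> ->.
by move/is_perm_size/eqP; rewrite size_eq0 => /eqP.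
Qed.

Lemma is_perm_idp n : is_perm n (idp n).
Proof. by rewrite /is_perm perm_refl. Qed.

Lemma index_idp n b : 0 < b -> b <= n -> index b (idp n) = b.-1.
Proof.
move=> b0 bn; rewrite -{1}(_ : nth 0 (idp n) b.-1 = b); last by rewrite nth_iota; lia.
by rewrite index_uniq ?iota_uniq // size_iota; lia.
Qed.

Lemma wle_idp n s : is_perm n s -> wle (idp n) s.
Proof.
move=> sn; apply/(wleP (is_perm_idp n) sn) => a b b0 ba an.
by rewrite !index_idp //; lia.
Qed.

Lemma is_perm_cons n p : is_perm n.+1 (n.+1 :: p) <-> is_perm n p.
Proof.
rewrite /is_perm -[X in iota _ X]addn1 iotaD add1n perm_sym perm_catC cat1s.
by rewrite perm_cons perm_sym.
Qed.

Lemma is_perm_ins n k p : is_perm n p -> is_perm n.+1 (c k p).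
Proof.
move=> pn; rewrite /is_perm /ins /= (is_perm_size pn) (perm_catCA _ [:: n.+1]) cat_take_drop.
exact/is_perm_cons.
Qed.

Lemma ins_rcons n p : is_perm n p -> c n p = rcons p n.+1.
Proof. by move=> /is_perm_size sz; rewrite /ins /= -sz take_size drop_size cats1. Qed.

Lemma ins_cons n p : is_perm n p -> c 0 p = n.+1 :: p.
Proof. by move=> /is_perm_size sz; rewrite /ins /= sz take0 drop0. Qed.

Lemma index_ins_top n k p : is_perm n p -> k <= n -> index n.+1 (c k p) = k.
Proof.
move=> pn kn; rewrite /ins /= (is_perm_size pn) index_cat.
rewrite ifN ?size_takel ?(is_perm_size pn) //= ?eqxx ?addn0 //.
by apply/negP => /mem_take; rewrite (is_perm_mem _ pn) ltnn andbF.
Qed.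

Lemma index_ins n k p b : is_perm n p -> k <= n -> 0 < b -> b <= n ->
  index b (c k p) = bump k (index b p).
Proof.
move=> pn kn b0 bn; rewrite /ins /= (is_perm_size pn) /bump.
have bm : b \in p by rewrite (is_perm_mem _ pn) b0.
rewrite index_cat size_takel ?(is_perm_size pn) //= ifN_eqC; last by rewrite neq_ltn ltnS bn.
have E : index b p = if b \in take k p then index b (take k p) else k + index b (drop k p).
  by rewrite -{1}(cat_take_drop k p) index_cat size_takel // (is_perm_size pn).
case: ifP => bt; rewrite E bt; last by rewrite leq_addr addnS.
by rewrite leqNgt -[X in _ < X](size_takel (n0 := k) (s := p)) ?index_mem ?bt // (is_perm_size pn).
Qed.

Lemma del_ins n k p : is_perm n p -> k <= n -> del (c k p) = p.
Proof.
move=> pn kn; rewrite /del (is_perm_size (is_perm_ins k pn)) /ins /= (is_perm_size pn).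
rewrite filter_cat /= eqxx -filter_cat cat_take_drop; apply/all_filterP/allP => x.
by rewrite (is_perm_mem _ pn) neq_ltn ltnS => /andP[_ ->].
Qed.

Lemma ins_inj n k l p q : is_perm n p -> is_perm n q -> k <= n -> l <= n ->
  c k p = c l q -> k = l /\ p = q.
Proof.
move=> pn qn kn ln E; have := del_ins pn kn; have := index_ins_top pn kn.
by rewrite E (del_ins qn ln) (index_ins_top qn ln).
Qed.

Lemma is_perm_ins_ex n s : is_perm n.+1 s ->
  exists k p, [/\ k <= n, is_perm n p & s = c k p].
Proof.
move=> sn; have nm : n.+1 \in s by rewrite (is_perm_mem _ sn) leqnn.
have us := is_perm_uniq sn.
move: nm => /splitPr sE; case: sE sn us => s1 s2 sn us.
have pn : is_perm n (s1 ++ s2).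
  by apply/is_perm_cons; move: sn; rewrite /is_perm (perm_catCA _ [:: n.+1]).
exists (size s1), (s1 ++ s2); split=> //.
  by rewrite -(is_perm_size pn) size_cat leq_addr.
by rewrite /ins /= (is_perm_size pn) take_size_cat // drop_size_cat.
Qed.

(** The inversions of [c k p] with larger value [n.+1] have as smaller values the entries of [p]
    from position [k] on. The second clause is the inclusion of these; all other inversions are
    those of [p] and [q]. *)
Lemma wle_ins n k l p q : is_perm n p -> is_perm n q -> k <= n -> l <= n ->
  wle (c k p) (c l q) <->
  wle p q /\ forall b, 0 < b -> b <= n -> k <= index b p -> l <= index b q.
Proof.
move=> pn qn kn ln; split.
  move/(wleP (is_perm_ins _ pn) (is_perm_ins _ qn)) => H; split.
    apply/(wleP pn qn) => a b b0 ba an.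
    by have := H a b b0 ba (leqW an); rewrite !(index_ins pn, index_ins qn) /bump //; lia.
  move=> b b0 bn kb; have := H n.+1 b b0; rewrite !ltnS => /(_ bn (leqnn _)).
  by rewrite (index_ins_top pn) ?(index_ins_top qn) ?(index_ins pn) ?(index_ins qn) /bump //; lia.
move=> [/(wleP pn qn) pq H].
apply/(wleP (is_perm_ins _ pn) (is_perm_ins _ qn)) => a b b0 ba.
rewrite leq_eqVlt => /orP[/eqP Ea|]; rewrite ?ltnS.
  subst a; rewrite (index_ins_top pn) ?(index_ins_top qn) ?(index_ins pn) ?(index_ins qn) /bump //.
  by have := H b b0; lia.
move=> an; rewrite !(index_ins pn, index_ins qn) /bump; try lia.
by have := pq a b b0 ba an; lia.
Qed.

Lemma wle_ins_id n k l p : is_perm n p -> l <= k -> k <= n -> wle (c k p) (c l p).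
Proof. by move=> pn lk kn; apply/(wle_ins pn pn kn (leq_trans lk kn)); split=> //; lia. Qed.

Lemma wle_insn n l p q : is_perm n p -> is_perm n q -> l <= n ->
  wle (c n p) (c l q) <-> wle p q.
Proof.
move=> pn qn ln; split; first by move/(wle_ins pn qn)=> [].
move=> pq; apply/(wle_ins pn qn (leqnn n) ln); split=> // b b0 bn.
by have := index_perm_ltn pn b0 bn; lia.
Qed.

Lemma wle_ins0 n k p q : is_perm n p -> is_perm n q -> k <= n ->
  wle (c k p) (c 0 q) <-> wle p q.
Proof.
move=> pn qn ln; split; first by move/(wle_ins pn qn)=> [].
by move=> pq; apply/(wle_ins pn qn ln).
Qed.

(** The right [l] is the largest one for which every value at position at least [k] in [p] is at
    position at least [l] in [q]: [n.+1] is inserted as late as the inversions forced by [c k p]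
    permit. *)
Lemma is_join_ins n k p q : is_perm n p -> is_perm n q -> wle p q -> k <= n ->
  exists l, l <= n /\ is_join n.+1 (c k p) (c n q) (c l q).
Proof.
move=> pn qn pq kn.
pose P l := all (fun b => (k <= index b p) ==> (l <= index b q)) (iota 1 n) && (l <= n).
have P0 : exists l, P l by exists 0; rewrite /P andbT; apply/allP => b _; apply/implyP.
have Pn l : P l -> l <= n by case/andP.
case: (ex_maxnP P0 Pn) => l /andP[Hl ln] Hmax.
have Hl' b : 0 < b -> b <= n -> k <= index b p -> l <= index b q.
  move=> b0 bn; have /(allP Hl)/implyP//: b \in iota 1 n by rewrite mem_iota; lia.
exists l; split=> //; split; first exact: is_perm_ins.
- exact/(wle_ins pn qn kn ln).
- exact/(wle_insn qn qn ln).
move=> _ /is_perm_ins_ex[m [z [mn zn ->]]] /(wle_ins pn zn kn mn)[pz Hz].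
move/(wle_insn qn zn mn) => qz; apply/(wle_ins qn zn ln mn); split=> // b b0 bn lb.
have ln' : l < n by have := index_perm_ltn qn b0 bn; lia.
(* Maximality of [l] yields a value [b1] at position exactly [l] of [q] and at position at least [k]
   of [p]. *)
have /allPn[b1] : ~~ all (fun b => (k <= index b p) ==> (l.+1 <= index b q)) (iota 1 n).
  by apply/negP => A; have := Hmax l.+1; rewrite /P A ln' ltnn => /(_ isT).
rewrite mem_iota negb_imply => /andP[b10 b1n] /andP[kb1 b1l].
have {}b1n : b1 <= n by lia.
have lb1 := Hl' b1 b10 b1n kb1.
have zb1 := Hz b1 b10 b1n kb1.
(* If [b < b1], the inversion of [b1] and [b] in [q] persists in [z]. If [b1 < b], then [b] cannot
   precede [b1] in [p], for this inversion would persist in [q]; so [b] too is at position at least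
   [k] of [p]. *)
case: (ltngtP b b1) => [bb|bb|->//].
  have : index b1 q < index b q.
    have : index b q <> index b1 q by move/(index_inj_perm qn b0 bn); lia.
    lia.
  by move/((wleP qn zn).1 qz b1 b b0 bb b1n); lia.
apply: Hz => //; move: ((wleP pn qn).1 pq b b1 b10 bb bn); lia.
Qed.

(** Dually, [l] is the least position such that all values of [q] from there on stand at position at
    least [k] in [p]. *)
Lemma is_meet_ins n k p q : is_perm n p -> is_perm n q -> wle q p -> k <= n ->
  exists l, l <= n /\ is_meet n.+1 (c k p) (c 0 q) (c l q).
Proof.
move=> pn qn qp kn.
pose P l := all (fun b => (l <= index b q) ==> (k <= index b p)) (iota 1 n) && (l <= n).
have Pn : exists l, P l.
  exists n; rewrite /P leqnn andbT; apply/allP => b; rewrite mem_iota => bn; apply/implyP.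
  by have := @index_perm_ltn _ _ b qn; lia.
case: (ex_minnP Pn) => l /andP[Hl ln] Hmin.
have Hl' b : 0 < b -> b <= n -> l <= index b q -> k <= index b p.
  move=> b0 bn; have /(allP Hl)/implyP//: b \in iota 1 n by rewrite mem_iota; lia.
exists l; split=> //; split; first exact: is_perm_ins.
- exact/(wle_ins qn pn ln kn).
- exact/(wle_ins0 qn qn ln).
move=> _ /is_perm_ins_ex[m [z [mn zn ->]]] /(wle_ins zn pn mn kn)[zp Hz].
move/(wle_ins0 zn qn mn) => zq; apply/(wle_ins zn qn mn ln); split=> // b b0 bn mb.
rewrite leqNgt; apply/negP => bl.
(* Here [l] is positive, and its minimality yields [b1] at position [l.-1] of [q] and before
   position [k] of [p]. Each way of comparing [b1] with [b] is contradictory. *)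
have /allPn[b1] : ~~ all (fun b => (l.-1 <= index b q) ==> (k <= index b p)) (iota 1 n).
  by apply/negP => A; have := Hmin l.-1; rewrite /P A; lia.
rewrite mem_iota negb_imply => /andP[b10 b1n] /andP[lb1 kb1].
have {}b1n : b1 <= n by lia.
have b1m : index b1 z < m by have := Hz b1 b10 b1n; lia.
have b1l : index b1 q < l by have := Hl' b1 b10 b1n; lia.
case: (ltngtP b b1) => [bb|bb|E].
- have : ~~ (index b1 q < index b q) by lia.
  move=> N; have : ~~ (index b1 z < index b z).
    by apply: contra N; apply: ((wleP zn qn).1 zq b1 b b0 bb b1n).
  by lia.
- have : index b q < index b1 q.
    have : index b q <> index b1 q by move/(index_inj_perm qn b0 bn); lia.
    lia.
  move/((wleP qn pn).1 qp b b1 b10 bb bn) => ?.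
  by have := Hz b b0 bn mb; lia.
- by move: mb; rewrite E; lia.
Qed.

(** The join of the deletions determines the fibre of the join. Both permutations are lifted into it
    by [is_join_ins], and the higher of the two lifts is the one with the smaller position. *)
Lemma is_join_ex n x y : is_perm n x -> is_perm n y -> exists j, is_join n x y j.
Proof.
elim: n x y => [|n IH] x y.
  by move=> /is_perm0-> /is_perm0->; exists [::]; split.
move=> /is_perm_ins_ex[i [p [i_n pn ->]]] /is_perm_ins_ex[j [q [j_n qn ->]]].
have [u [un pu qu Hu]] := IH p q pn qn.
have [k [kn [_ k1 k2 k3]]] := is_join_ins pn un pu i_n.
have [l [ln [_ l1 l2 l3]]] := is_join_ins qn un qu j_n.
exists (c (minn k l) u); split; first exact: is_perm_ins.
- by apply: wle_trans k1 _; apply: (wle_ins_id un); lia.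
- by apply: wle_trans l1 _; apply: (wle_ins_id un); lia.
move=> _ /is_perm_ins_ex[m [z [mn zn ->]]] pz qz.
have uz : wle (c n u) (c m z).
  apply/(wle_insn un zn mn); apply: Hu => //.
    by have /(wle_ins pn zn i_n mn)[] := pz.
  by have /(wle_ins qn zn j_n mn)[] := qz.
by rewrite /minn; case: ifP => _; [apply: k3|apply: l3] => //; exact: is_perm_ins.
Qed.

Lemma is_meet_ex n x y : is_perm n x -> is_perm n y -> exists m, is_meet n x y m.
Proof.
elim: n x y => [|n IH] x y.
  by move=> /is_perm0-> /is_perm0->; exists [::]; split.
move=> /is_perm_ins_ex[i [p [i_n pn ->]]] /is_perm_ins_ex[j [q [j_n qn ->]]].
have [u [un pu qu Hu]] := IH p q pn qn.
have [k [kn [_ k1 k2 k3]]] := is_meet_ins pn un pu i_n.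
have [l [ln [_ l1 l2 l3]]] := is_meet_ins qn un qu j_n.
exists (c (maxn k l) u); split; first exact: is_perm_ins.
- by apply: wle_trans k1; apply: (wle_ins_id un); lia.
- by apply: wle_trans l1; apply: (wle_ins_id un); lia.
move=> _ /is_perm_ins_ex[m [z [mn zn ->]]] pz qz.
have uz : wle (c m z) (c 0 u).
  apply/(wle_ins0 zn un mn); apply: Hu => //.
    by have /(wle_ins zn pn mn i_n)[] := pz.
  by have /(wle_ins zn qn mn j_n)[] := qz.
by rewrite /maxn; case: ifP => _; [apply: l3|apply: k3] => //; exact: is_perm_ins.
Qed.

(** * Congruences and their restrictions *)

Lemma is_join_le n x y : is_perm n y -> wle x y -> is_join n x y y.
Proof. by move=> yn xy; split. Qed.

Lemma is_join_insn n x y j : is_perm n x -> is_perm n y -> is_join n x y j ->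
  is_join n.+1 (c n x) (c n y) (c n j).
Proof.
move=> xn yn [jn xj yj H]; split; first exact: is_perm_ins.
- exact/(wle_insn xn jn).
- exact/(wle_insn yn jn).
move=> _ /is_perm_ins_ex[k [z [kn zn ->]]] /(wle_insn xn zn kn) xz /(wle_insn yn zn kn) yz.
by apply/(wle_insn jn zn kn)/H.
Qed.

Lemma is_meet_insn n x y m : is_perm n x -> is_perm n y -> is_meet n x y m ->
  is_meet n.+1 (c n x) (c n y) (c n m).
Proof.
move=> xn yn [mn mx my H]; split; first exact: is_perm_ins.
- exact/(wle_insn mn xn).
- exact/(wle_insn mn yn).
move=> _ /is_perm_ins_ex[k [z [kn zn ->]]] /(wle_ins zn xn kn (leqnn n))[zx Hk].
move=> /(wle_ins zn yn kn (leqnn n))[zy _].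
apply/(wle_ins zn mn kn (leqnn n)); split; first exact: H.
by move=> b b0 bn /(Hk _ b0 bn); have := index_perm_ltn xn b0 bn; lia.
Qed.

Lemma restrE n (e : seq nat -> seq nat -> Prop) p q :
  is_perm n p -> is_perm n q -> restr e p q = e (c n p) (c n q).
Proof. by rewrite /restr => /is_perm_size-> /is_perm_size->. Qed.

Section Congruence.
Variables (n : nat) (e : seq nat -> seq nat -> Prop).

(** Joining [x] and [z] with [y] gives [y] and [z], so [y] is equivalent to [z]. *)
Lemma cong_convex x y z : lattice_congruence n e ->
  is_perm n x -> is_perm n y -> is_perm n z -> wle x y -> wle y z -> e x z -> e x y.
Proof.
move=> [er es et ej em] xn yn zn xy yz xz.
apply: (et _ z) => //; apply: es => //.
by apply: (ej x z y y) => //; [exact: er|exact: is_join_le|]; split.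
Qed.

Lemma cong_restr : lattice_congruence n.+1 e -> lattice_congruence n (restr e).
Proof.
move=> [er es et ej em]; have P p : is_perm n p -> is_perm n.+1 (c n p) by exact: is_perm_ins.
split.
- by move=> x xn; rewrite (restrE _ xn xn); apply/er/P.
- by move=> x y xn yn; rewrite (restrE _ xn yn) (restrE _ yn xn); apply: es; exact: P.
- move=> x y z xn yn zn; rewrite (restrE _ xn yn) (restrE _ yn zn) (restrE _ xn zn).
  by apply: et; exact: P.
- move=> x x' y y' j j' xn xn' yn yn'; rewrite (restrE _ xn xn') (restrE _ yn yn') => ex ey H H'.
  have [[jn _ _ _] [jn' _ _ _]] := (H, H'); rewrite (restrE _ jn jn').
  by apply: (ej (c n x) (c n x') (c n y) (c n y')) => //; try exact: P; exact: is_join_insn.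
- move=> x x' y y' j j' xn xn' yn yn'; rewrite (restrE _ xn xn') (restrE _ yn yn') => ex ey H H'.
  have [[jn _ _ _] [jn' _ _ _]] := (H, H'); rewrite (restrE _ jn jn').
  by apply: (em (c n x) (c n x') (c n y) (c n y')) => //; try exact: P; exact: is_meet_insn.
Qed.

End Congruence.

(** Meeting with the bottom of a fibre over some [w] above [p] forgets where [n.+1] stands and lands
    at the bottom of the fibre of [p]. *)
Lemma is_meet_ins_insn n k p w : is_perm n p -> is_perm n w -> wle p w -> k <= n ->
  is_meet n.+1 (c k p) (c n w) (c n p).
Proof.
move=> pn wn pw kn; split; first exact: is_perm_ins.
- exact/(wle_insn pn pn kn).
- exact/(wle_insn pn wn).
move=> _ /is_perm_ins_ex[l [z [ln zn ->]]] /(wle_ins zn pn ln kn)[zp _].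
move/(wle_ins zn wn ln (leqnn n)) => [_ Hz]; apply/(wle_ins zn pn ln (leqnn n)); split=> //.
by move=> b b0 bn /(Hz _ b0 bn); have := index_perm_ltn wn b0 bn; lia.
Qed.

Lemma is_join_ins_ins0 n k p w : is_perm n p -> is_perm n w -> wle w p -> k <= n ->
  is_join n.+1 (c k p) (c 0 w) (c 0 p).
Proof.
move=> pn wn wp kn; split; first exact: is_perm_ins.
- exact/(wle_ins0 pn pn kn).
- exact/(wle_ins0 wn pn).
move=> _ /is_perm_ins_ex[l [z [ln zn ->]]] /(wle_ins pn zn kn ln)[pz _].
move/(wle_ins wn zn (leq0n n) ln) => [_ Hz]; apply/(wle_ins pn zn (leq0n n) ln); split=> //.
Qed.

Lemma idp_ins n : idp n.+1 = c n (idp n).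
Proof.
by rewrite (ins_rcons (is_perm_idp n)) /idp -[X in iota _ X]addn1 iotaD cats1 add1n.
Qed.

(** * Equivalence in the fibres against equivalence of the deletions *)

Section Projection.
Variables (n : nat) (e : seq nat -> seq nat -> Prop).
Hypothesis ce : lattice_congruence n.+1 e.

Let er p k : is_perm n p -> e (c k p) (c k p).
Proof. by case: ce => er _ _ _ _ pn; exact/er/is_perm_ins. Qed.

(** For [w] the join of [p] and [q], meeting with [c n w] sends both sides to the bottoms of their
    fibres at once. *)
Lemma restr_of_ins k l p q : is_perm n p -> is_perm n q -> k <= n -> l <= n ->
  e (c k p) (c l q) -> restr e p q.
Proof.
case: ce => _ _ _ _ em pn qn kn ln H; rewrite (restrE _ pn qn).
have [w [wn pw qw _]] := is_join_ex pn qn.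
apply: (em (c k p) (c l q) (c n w) (c n w)) => //; try exact: is_perm_ins.
- exact: er.
- exact: is_meet_ins_insn.
- exact: is_meet_ins_insn.
Qed.

(** For [w] the meet of [p] and [q], joining with [c 0 w] moves both bottoms to the tops. *)
Lemma restr_ins0 p q : is_perm n p -> is_perm n q -> restr e p q -> e (c 0 p) (c 0 q).
Proof.
case: ce => _ _ _ ej _ pn qn; rewrite (restrE _ pn qn) => H.
have [w [wn wp wq _]] := is_meet_ex pn qn.
apply: (ej (c n p) (c n q) (c 0 w) (c 0 w)) => //; try exact: is_perm_ins.
- exact: er.
- exact: is_join_ins_ins0.
- exact: is_join_ins_ins0.
Qed.

(* Go up from p to the join of p and q, then down to q. *)
Lemma restr_transfer k p q : is_perm n p -> is_perm n q -> k <= n -> restr e p q ->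
  exists l, l <= n /\ e (c k p) (c l q).
Proof.
move=> pn qn kn H; have cr := cong_restr ce.
have [u Hu] := is_join_ex pn qn; have [un pu qu _] := Hu.
have pu_e : restr e p u.
  case: cr => rr _ _ rj _; apply: (rj p p p q) => //; try exact: rr.
  by split.
have qu_e : restr e q u.
  case: cr => _ rs rt _ _; apply: (rt _ p) => //; exact: rs.
have [l [ln Hl]] := is_join_ins pn un pu kn.
have [m [mn Hm]] := is_meet_ins un qn qu ln.
exists m; split=> //; case: ce => _ _ et ej em.
apply: (et _ (c l u)); try exact: is_perm_ins.
  apply: (ej (c k p) (c k p) (c n p) (c n u)) => //; try exact: is_perm_ins.
  - exact: er.
  - by rewrite -restrE.
  - by split=> //; [exact: is_perm_ins|exact/(wle_insn pn pn kn)].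
apply: (em (c l u) (c l u) (c 0 u) (c 0 q)) => //; try exact: is_perm_ins.
- exact: er.
- by apply: restr_ins0 => //; case: cr => _ rs _ _ _; exact: rs.
- by split=> //; [exact: is_perm_ins|exact/(wle_ins0 un un ln)].
Qed.

(** Meeting the two ends of the fibre with [c n.-1 (idp n)] leaves [c n.-1 (idp n)] and
    [c n (idp n)]. Hence one collapsed fibre already forces the second case of the recursive
    construction. *)
Lemma cong_idp_of_fibre p : is_perm n p -> e (c 0 p) (c n p) -> e (idp n.+1) (ins n (idp n)).
Proof.
have idn := is_perm_idp n.
rewrite idp_ins.
(* For [n = 0] both sides are the same permutation, because [ins 0] and [ins 1] agree by
   [0.-1 = 0]. *)
case: n ce idn p er => [|m]; first by move=> _ idn' p' e1 _ _; exact: (e1 [::] 0).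
move=> [_ es _ _ em] idn p er' pn H.
apply: es; try exact: is_perm_ins.
apply: (em (c 0 p) (c m.+1 p) (c m (idp m.+1)) (c m (idp m.+1))) => //; try exact: is_perm_ins.
- exact: er'.
- split=> //; first exact: is_perm_ins.
  by apply/(wle_ins0 idn pn) => //; exact: wle_idp.
- split; first exact: is_perm_ins.
  + by apply/(wle_insn idn pn) => //; exact: wle_idp.
  + exact/(wle_insn idn idn).
  move=> _ /is_perm_ins_ex[l [z [ln zn ->]]] /(wle_ins zn pn ln (leqnn _))[zp Hz].
  move/(wle_ins zn idn ln (leqnSn _)) => [zi _].
  apply/(wle_ins zn idn ln (leqnn _)); split=> // b b0 bn /(Hz _ b0 bn).
  by have := index_perm_ltn pn b0 bn; lia.
Qed.

(* For w >= p starting with its largest value, c 0 w is the join of c n w and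
   c n.-1 (idp n); meeting c n w ~ c 0 w with c 0 p gives the claim. *)
Lemma cong_fibre_of_idp p : is_perm n p -> e (idp n.+1) (ins n (idp n)) -> e (c 0 p) (c n p).
Proof.
have idn := is_perm_idp n.
rewrite idp_ins.
case: n ce idn p er => [|m]; first by move=> _ idn' p' e1 pn _; exact: (e1 p' 0).
move=> [_ es _ ej em] idn p er' pn H.
have [i [p' [im pn' Ep]]] := is_perm_ins_ex pn.
pose w := c 0 p'; have wn : is_perm m.+1 w by exact: is_perm_ins.
have pw : wle p w by rewrite Ep; apply: (wle_ins_id pn').
have Hw : e (c 0 w) (c m.+1 w).
  apply: es; try exact: is_perm_ins.
  apply: (ej (c m.+1 w) (c m.+1 w) (c m.+1 (idp m.+1)) (c m (idp m.+1))) => //; try exact: is_perm_ins.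
  - exact: er'.
  - split=> //; first exact: is_perm_ins.
    by apply/(wle_insn idn wn) => //; exact: wle_idp.
  - split; first exact: is_perm_ins.
    + exact/(wle_insn wn wn).
    + by apply/(wle_ins0 idn wn) => //; exact: wle_idp.
    move=> _ /is_perm_ins_ex[l [z [ln zn ->]]] /(wle_insn wn zn ln) wz.
    move/(wle_ins idn zn (leqnSn _) ln) => [_ /(_ m.+1 isT (leqnn _))].
    rewrite index_idp // => /(_ (leqnn _)) lz.
    apply/(wle_ins wn zn (leq0n _) ln); split=> // b b0 bn _.
    (* Since [w] starts with its largest value and [w] is below [z], so does [z]: the entry at the
       head of [z'], if any, forces [i' = 0], and then [l = 0]. *)
    have [i' [z' [im' zn' Ez]]] := is_perm_ins_ex zn.
    move: wz lz; rewrite Ez /w => /(wle_ins pn' zn' (leq0n _) im')[_ Hz].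
    rewrite (index_ins_top zn' im'); suff : i' = 0 by lia.
    case: (posnP m) => m0; first by lia.
    have [a0 am Ea] := is_perm_nth zn' m0.
    by have := Hz _ a0 am (leq0n _); rewrite Ea; lia.
apply: (em (c 0 p) (c 0 p) (c 0 w) (c m.+1 w)) => //; try exact: is_perm_ins.
- exact: er'.
- split=> //; first exact: is_perm_ins.
  exact/(wle_ins0 pn wn).
- exact: is_meet_ins_insn.
Qed.

End Projection.

(** * Cover relations and representatives *)

Lemma inversion_ins n k p a b : is_perm n p -> k <= n ->
  inversion (c k p) a b <->
  inversion p a b \/ [/\ a = n.+1, 0 < b, b <= n & k <= index b p].
Proof.
move=> pn kn; have ipn := is_perm_ins k pn; split.
  move=> /(inversionP _ _ ipn)[b0 ba + b1].
  rewrite leq_eqVlt => /orP[/eqP Ea|an]; last first.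
    left; apply/(inversionP _ _ pn); split=> //.
    by move: b1; rewrite !(index_ins pn) /bump; lia.
  right; split=> //; first by lia.
  by move: b1; rewrite Ea (index_ins_top pn) // (index_ins pn) /bump; lia.
case=> [/(inversionP _ _ pn)[b0 ba an iab]|[-> b0 bn kb]]; apply/(inversionP _ _ ipn).
  by split=> //; [lia|rewrite !(index_ins pn) /bump; lia].
by split=> //; rewrite (index_ins_top pn) // (index_ins pn) // /bump kb; lia.
Qed.

(* In the weak order this says that y covers x or has the same inversions. *)
Definition wcov (x y : seq nat) : Prop :=
  wle x y /\ exists a b, forall a' b', inversion y a' b' ->
    inversion x a' b' \/ a' = a /\ b' = b.

Lemma wcov_between x y w : wcov x y -> wle x w -> wle w y -> wle w x \/ wle y w.
Proof.
move=> [_ [a [b H]]] xw wy; have [wab|nwab] := EM (inversion w a b).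
  by right=> a' b' /H[/xw|[-> ->]].
by left=> a' b' wab'; have [//|[Ea Eb]] := H _ _ (wy _ _ wab'); case: nwab; rewrite -Ea -Eb.
Qed.

Lemma wcov_insn n p q : is_perm n p -> is_perm n q -> wcov p q -> wcov (c n p) (c n q).
Proof.
move=> pn qn [pq [a [b H]]]; split; first exact/(wle_insn pn qn).
exists a, b => a' b' /(inversion_ins _ _ qn (leqnn n))[/H[H1|]|]; [|by right|].
  by left; apply/(inversion_ins _ _ pn (leqnn n)); left.
by case=> _ b0 bn; have := index_perm_ltn qn b0 bn; lia.
Qed.

Lemma wcov_ins0 n p q : is_perm n p -> is_perm n q -> wcov p q -> wcov (c 0 p) (c 0 q).
Proof.
move=> pn qn [pq [a [b H]]]; split; first exact/(wle_ins0 pn qn).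
exists a, b => a' b' /(inversion_ins _ _ qn (leq0n n))[/H[H1|]|]; [|by right|].
  by left; apply/(inversion_ins _ _ pn (leq0n n)); left.
by case=> Ea b0 bn _; left; apply/(inversion_ins _ _ pn (leq0n n)); right.
Qed.

(** Shifting [n.+1] by one place makes it pass only the entry at position [k] of [p], which gives
    the single new inversion. *)
Lemma wcov_ins n k p : is_perm n p -> k < n -> wcov (c k.+1 p) (c k p).
Proof.
move=> pn kn; split; first by apply: (wle_ins_id pn); lia.
exists n.+1, (nth 0 p k) => a b /(inversion_ins _ _ pn (ltnW kn))[H|[-> b0 bn]].
  by left; apply/(inversion_ins _ _ pn kn); left.
rewrite leq_eqVlt => /orP[/eqP Ek|kb].
  by right; rewrite Ek nth_index // (is_perm_mem _ pn) b0.
by left; apply/(inversion_ins _ _ pn kn); right.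
Qed.

Definition adjacent_classes n (e : seq nat -> seq nat -> Prop) x y : Prop :=
  ~ e x y /\ exists x' y', [/\ is_perm n x', is_perm n y', e x x', e y y' & wcov x' y'].

Lemma adjacent_classes_qcover n e x y : lattice_congruence n e ->
  is_perm n x -> is_perm n y -> adjacent_classes n e x y -> qcover n e x y.
Proof.
move=> ce; have [er es et ej em] := ce.
move=> xn yn [nxy [x' [y' [x'n y'n xx' yy' cxy]]]].
split.
  by split=> //; exists x', y'; split=> //; [apply: es|apply: es|case: cxy].
move=> [z [zn [nxz [u [z1 [un z1n ux z1z uz1]]]] [nzy [z2 [v [z2n vn z2z vy z2v]]]]]].
(* As [u] lies below [z1], the join of [z1] with [u] is [z1]. Replacing [u] by the equivalent [x']
   stays in the class of [z] and gives a member above [x']. *)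
have [zj Hzj] := is_join_ex z1n x'n; have [zjn z1zj x'zj _] := Hzj.
have e1 : e z1 zj.
  apply: (ej z1 z1 u x') => //; first exact: er.
    by apply: (et _ x).
  by split.
have e2 : e zj z by apply: (et _ z1) => //; apply: es.
(* Dually, [z2] is its own meet with [v]; replacing [z2] by [zj] and [v] by [y'] gives [w] in the
   class of [z], between [x'] and [y']. *)
have [w Hw] := is_meet_ex zjn y'n; have [wn wzj wy' Hm] := Hw.
have e3 : e z w.
  apply: (et _ z2) => //; first exact: es.
  apply: (em z2 zj v y') => //; last by split.
    by apply: (et _ z) => //; exact: es.
  by apply: (et _ y).
have x'w : wle x' w by apply: Hm => //; case: cxy.
case: (wcov_between cxy x'w wy') => H.
  apply: nxz; apply: (et _ x') => //; apply: (et _ w) => //; last exact: es.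
  (* Antisymmetry is avoided: two mutually comparable permutations are both joins of the same pair,
     hence equivalent. *)
  by apply: (ej x' x' w w) => //; try exact: er; split.
apply: nzy; apply: (et _ w) => //; apply: (et _ y') => //; last exact: es.
by apply: (ej w w y' y') => //; try exact: er; split.
Qed.

Lemma adjacent_classes_insn n e p q : lattice_congruence n.+1 e ->
  is_perm n p -> is_perm n q ->
  adjacent_classes n (restr e) p q -> adjacent_classes n.+1 e (c n p) (c n q).
Proof.
move=> ce pn qn [npq [x [y [xn yn px qy cxy]]]]; split; first by rewrite -restrE.
exists (c n x), (c n y); rewrite -!(@restrE n e) //.
by split=> //; try exact: is_perm_ins; exact: wcov_insn.
Qed.

Lemma adjacent_classes_ins0 n e p q : lattice_congruence n.+1 e ->
  is_perm n p -> is_perm n q ->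
  adjacent_classes n (restr e) p q -> adjacent_classes n.+1 e (c 0 p) (c 0 q).
Proof.
move=> ce pn qn [npq [x [y [xn yn px qy cxy]]]]; split.
  by move=> /(restr_of_ins ce pn qn (leq0n n) (leq0n n)).
exists (c 0 x), (c 0 y); split; try exact: is_perm_ins; try exact: (restr_ins0 ce).
exact: (wcov_ins0 xn yn cxy).
Qed.

(** * Choice of representatives, fibre by fibre *)

Lemma isR_is_perm n e R s : isR n e R -> R s -> is_perm n s.
Proof.
elim: n e R s => [|n IH] e R s; first by move=> H /H ->.
move=> [R' [HR' [[_ [F [HF HR]]]|[_ HR]]]] /HR.
  move=> [p [R'p Fp]]; have [_ _ /(_ _ Fp) H _] := HF _ R'p.
  case: H => -[|i] [i0 _ Es] //; rewrite Es.
  apply: is_perm_ins; exact: IH HR' R'p.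
by move=> [p [R'p ->]]; apply: is_perm_ins; exact: IH HR' R'p.
Qed.

Lemma isR_ex n e : lattice_congruence n e -> exists R, isR n e R.
Proof.
elim: n e => [|n IH] e ce; first by exists (fun s => s = [::]).
have [R' HR'] := IH _ (cong_restr ce).
have [H|H] := EM (e (idp n.+1) (ins n (idp n))).
  by exists (fun s => exists p, R' p /\ s = c n p), R'; split=> //; right.
(* The class of [c 0 p] is represented by [c 0 p], every other class by its member with the largest
   position. This keeps both ends of the fibre, which are inequivalent by [cong_idp_of_fibre]. *)
pose G p k := k = 0 \/ ~ e (c 0 p) (c k p) /\
                forall l, k < l -> l <= n -> ~ e (c k p) (c l p).
pose F p s := exists k, [/\ k <= n, s = c k p & G p k].
exists (fun s => exists p, R' p /\ F p s), R'; split=> //; left; split=> //.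
exists F; split=> // p R'p; have pn := isR_is_perm HR' R'p.
have [er es et _ _] := ce.
have FG k : k <= n -> F p (c k p) -> G p k.
  by move=> kn [l [ln /(ins_inj pn pn kn ln)[-> _]]].
split.
- by exists 0; split=> //; left.
- exists n; split=> //; right; split; last by move=> l; lia.
  by move=> /(cong_idp_of_fibre ce pn).
- by move=> _ [k [kn -> _]]; exists k.+1.
move=> [|i] // _; rewrite ltnS => i_n.
have Pn k : is_perm n.+1 (c k p) by exact: is_perm_ins.
have [e0|ne0] := EM (e (c i p) (c 0 p)).
  exists 1; split; first by split=> //; exists 0; split=> //; left.
  move=> [|j] [j0 jn Fj eij] //; case: (FG j jn Fj) => [->//|[[]]].
  by apply: (et _ (c i p)) => //; exact: es.
have exP : exists j, (j <= n) && `[< e (c i p) (c j p) >].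
  by exists i; rewrite i_n; apply/asboolP/er.
have ubP j : (j <= n) && `[< e (c i p) (c j p) >] -> j <= n by case/andP.
case: (ex_maxnP exP ubP) => j /andP[jn /asboolP eij] Hmax.
exists j.+1; split.
  split=> //; exists j; split=> //; right; split.
    by move=> e0j; apply: ne0; apply: (et _ (c j p)) => //; exact: es.
  move=> l jl ln ejl; have := Hmax l; rewrite ln leqNgt jl => /(_ _)/negP; apply=> //.
  by apply/asboolP; apply: (et _ (c j p)).
move=> [|l] [l0 ln Fl eil] //; congr _.+1; move: ln; rewrite ltnS => ln.
case: (FG l ln Fl) => [El|[_ Hl]]; first by case: ne0; rewrite -El.
have lj : l <= j by apply: Hmax; rewrite ln; exact/asboolP.
move: lj; rewrite leq_eqVlt => /orP[/eqP//|lj].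
by case: (Hl j lj jn); apply: (et _ (c i p)) => //; exact: es.
Qed.

(** The common outcome of both cases of the recursive construction, with positions counted from [0];
    only the last clause still distinguishes them. *)
Definition fibred n (e : seq nat -> seq nat -> Prop) (R R' : seq nat -> Prop) : Prop :=
  [/\ forall p, R' p -> is_perm n p,
      forall s, R s -> exists k p, [/\ k <= n, R' p & s = c k p],
      forall p k, R' p -> k <= n ->
        exists! j, [/\ j <= n, R (c j p) & e (c k p) (c j p)] &
      (forall p, R' p -> R (c 0 p) /\ R (c n p)) \/
      (forall s, R s <-> exists p, R' p /\ s = c n p)].

Lemma isR_fibred n e R : lattice_congruence n.+1 e -> isR n.+1 e R ->
  exists R', isR n (restr e) R' /\ fibred n e R R'.
Proof.
move=> ce [R' [HR' HF]]; exists R'; split=> //.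
have P p : R' p -> is_perm n p by exact: (isR_is_perm HR').
have [er es et ej em] := ce.
case: HF => [[_ [F [HF HR]]]|[eid HR]]; split=> //.
- move=> s /HR[p [R'p Fs]]; have [_ _ /(_ s Fs) H _] := HF p R'p.
  by case: H => -[|i] [i0 i_n ->] //; exists i, p.
- move=> p k R'p kn; have [_ _ HFs /(_ k.+1 isT kn)] := HF p R'p.
  (* A member of [R] over [p] can only come from [F p], since deletion determines the fibre. *)
  have RF j : j <= n -> R (c j p) <-> F p (c j p).
    move=> jn; split=> [/HR[q [R'q Fq]]|Fp]; last by apply/HR; exists p.
    have [_ _ /(_ _ Fq) H _] := HF q R'q.
    case: H => -[|i] [i0 i_n] // /(ins_inj (P _ R'p) (P _ R'q) jn i_n)[_ Epq].
    by rewrite Epq in Fq *.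
  move=> [[|j] [[j0 jn Fj ej'] Hj]] //; exists j; split.
    by split=> //; apply/RF.
  move=> l [ln Rl el]; suff [//] : j.+1 = l.+1 by [].
  by apply: Hj; split=> //; apply/RF.
- left=> p R'p; have [F0 Fn _ _] := HF p R'p.
  by split; apply/HR; exists p.
- by move=> s /HR[p [R'p ->]]; exists n, p.
- move=> p k R'p kn; have pn := P _ R'p; exists n; split.
    split=> //; first by apply/HR; exists p.
    (* The two ends of the fibre are equivalent, and by convexity so is everything between them; the
       bottom represents the whole fibre. *)
    have e0n := cong_fibre_of_idp ce pn eid.
    apply: (et _ (c 0 p)); try exact: is_perm_ins; last by [].
    have ek : e (c n p) (c k p).
      apply: (cong_convex ce _ _ _ _ _ (es _ _ _ _ e0n)); try exact: is_perm_ins.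
        exact/(wle_insn pn pn).
      exact/(wle_ins0 pn pn).
    apply: es; try exact: is_perm_ins.
    by apply: (et _ (c n p)); try exact: is_perm_ins.
  move=> l [ln /HR[q [R'q /(ins_inj pn (P _ R'q) ln (leqnn n))[-> _]]] _].
  by [].
by right.
Qed.

(** Existence transfers [c k p] into the fibre of the representative of [p]. For uniqueness,
    [restr_of_ins] confines all candidates to that one fibre. *)
Lemma isR_representatives n e R : lattice_congruence n e -> isR n e R ->
  forall s, is_perm n s -> exists! r, R r /\ e s r.
Proof.
elim: n e R => [|n IH] e R ce.
  move=> HR s /is_perm0->; exists [::]; split; last by move=> r [/HR->].
  by split; [exact/HR|case: ce => er _ _ _ _; exact/er].
move=> /(isR_fibred ce)[R' [HR' [P HR Hu _]]] _ /is_perm_ins_ex[k [p [kn pn ->]]].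
have [q [[R'q epq] Hq]] := IH _ _ (cong_restr ce) HR' p pn.
have qn := P q R'q; have [er es et _ _] := ce.
have [l [ln ekl]] := restr_transfer ce pn qn kn epq.
have [j [[jn Rj elj] Hj]] := Hu q l R'q ln.
exists (c j q); split.
  by split=> //; apply: (et _ (c l q)) => //; exact: is_perm_ins.
move=> x [Rr]; have [i [r [i_n R'r Ex]]] := HR x Rr; subst x => er'; have rn := P r R'r.
have Eq : q = r by apply: Hq; split=> //; exact: (restr_of_ins ce pn rn kn i_n er').
subst r; congr (ins _.+1 _); apply: Hj; split=> //.
apply: (et _ (c k p)) => //; try exact: is_perm_ins.
by apply: es => //; exact: is_perm_ins.
Qed.

Lemma zigzag_ext n (L M : seq nat -> Prop) :
  (forall s, L s <-> M s) -> zigzag n L -> zigzag n M.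
Proof.
by move=> H; have -> : L = M by apply: funext => s; apply: propext.
Qed.

(** * Jumps *)

Lemma fibred_sub n e R R' p : fibred n e R R' -> R' p -> R (c n p).
Proof.
move=> [_ _ _ [H|H]] R'p; first by case: (H p R'p).
by apply/H; exists p.
Qed.

Lemma isR_zigzag n e R : lattice_congruence n e -> isR n e R -> zigzag n R.
Proof.
elim: n e R => [//|n IH] e R ce HRn; have := HRn.
move=> /(isR_fibred ce)[R' [HR' fR]]; have [P HR Hu Hz] := fR.
have L' s : R' s <-> exists t, R t /\ del t = s.
  split=> [R's|[t [/HR[k [p [kn R'p ->]]]]]].
    exists (c n s); split; first exact: fibred_sub fR R's.
    by rewrite (del_ins (P _ R's)).
  by rewrite (del_ins (P _ R'p)) // => <-.
split.
- by move=> s; exact: isR_is_perm HRn.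
- exact: zigzag_ext L' (IH _ _ (cong_restr ce) HR').
case: Hz => H; first by left=> p /L'; exact: H.
by right=> s; rewrite H; split=> -[p [/L' R'p ->]]; exists p.
Qed.

Lemma is_perm_split n s v : is_perm n s -> v \in s ->
  exists a b : seq nat, [/\ s = a ++ v :: b, index v s = size a & v \notin a].
Proof.
move=> sn vs; have us := is_perm_uniq sn.
case/splitPr: vs us => a b; rewrite cat_uniq /= negb_or => /and3P[_ /andP[va _] _].
by exists a, b; split=> //; rewrite index_cat (negPf va) /= eqxx addn0.
Qed.

Lemma is_perm_rjump n s v d : is_perm n s -> rjump_ok s v d -> is_perm n (rjump s v d).
Proof.
move=> sn [/(is_perm_split sn)[a [b [Es Ei _]]] _]; rewrite /rjump Ei.
move: sn; rewrite Es /is_perm take_size_cat // -addnS !drop_cat.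
rewrite !ltnNge leq_addr leqnSn /= subSnn addKn /= drop0.
move=> H; rewrite -(permPl (_ : perm_eq (a ++ v :: b) _)) // perm_cat2l.
by rewrite perm_sym (perm_catCA _ [:: v]) /= cat_take_drop.
Qed.

Lemma is_perm_ljump n s v d : is_perm n s -> ljump_ok s v d -> is_perm n (ljump s v d).
Proof.
move=> sn [/(is_perm_split sn)[a [b [Es Ei _]]] [dl _]]; rewrite /ljump Ei.
rewrite Ei in dl.
move: sn; rewrite Es /is_perm => H; rewrite -(permPl (_ : perm_eq (a ++ v :: b) _)) //.
rewrite -{1}(cat_take_drop (size a - d) a) -catA take_cat drop_cat.
case: ltnP => ad.
  rewrite perm_cat2l take_cat size_drop ifN ?subKn ?ltnn // subnn cats0.
  rewrite drop_cat ltnNge leqnSn /= subSnn /= drop0.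
  by rewrite perm_sym (perm_catCA [:: v]).
have -> : d = 0 by lia.
rewrite subn0 subnn !take0 take_size drop_size cats0 /= drop_cat ltnNge leqnSn /= subSnn /= drop0.
by [].
Qed.

(** * Jumps of smaller values when the largest value stands at an end *)

Section BoundaryInsertion.
Variables (n : nat) (p : seq nat) (v d : nat).
Hypotheses (pn : is_perm n p) (vn : v <= n).

Lemma rjump_ok_ins0 : rjump_ok (c 0 p) v d <-> rjump_ok p v d.
Proof.
rewrite (ins_cons pn) /rjump_ok inE /= (gtn_eqF (_ : v < n.+1)) //= eq_sym.
by rewrite (gtn_eqF (_ : v < n.+1)).
Qed.

Lemma rjump_ins0 : rjump (c 0 p) v d = n.+1 :: rjump p v d.
Proof. by rewrite (ins_cons pn) /rjump /= (gtn_eqF (_ : v < n.+1)). Qed.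

Lemma ljump_ok_ins0 : ljump_ok (c 0 p) v d <-> ljump_ok p v d.
Proof.
rewrite (ins_cons pn) /ljump_ok inE /= (gtn_eqF (_ : v < n.+1)) // eq_sym (gtn_eqF (_ : v < n.+1)) //=.
split=> -[vp [dl H]]; split=> //.
  (* A longer jump would have to pass the leading [n.+1], which is not smaller than [v]. *)
  have di : d <= index v p.
    rewrite leqNgt; apply/negP => id; have := H d; rewrite (_ : _ - d = 0) /=; lia.
  split=> // k k0 kd; have := H k k0 kd; rewrite subSn //; lia.
by split; [lia|move=> k k0 kd; rewrite subSn /=; [exact: H|lia]].
Qed.

Lemma ljump_ins0 : ljump_ok p v d -> ljump (c 0 p) v d = n.+1 :: ljump p v d.
Proof.
by move=> [_ [dl _]]; rewrite (ins_cons pn) /ljump /= (gtn_eqF (_ : v < n.+1)) // subSn.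
Qed.

Lemma rjump_ok_insn : rjump_ok (c n p) v d <-> rjump_ok p v d.
Proof.
rewrite (ins_rcons pn) /rjump_ok mem_rcons inE (ltn_eqF (_ : v < n.+1)) //=.
split=> -[vp]; rewrite size_rcons -cats1 index_cat vp => -[dl H].
  (* Likewise a jump to the last position would have to pass the final [n.+1]; the jump by [0] steps
     is treated apart. *)
  have di : index v p + d < size p.
    move: dl; rewrite ltnS leq_eqVlt => /orP[/eqP E|//].
    case: (posnP d) => d0; first by rewrite d0 addn0 index_mem.
    by have := H d d0 (leqnn d); rewrite nth_cat E ltnn subnn /=; lia.
  do 2!split=> //; move=> k k0 kd; have := H k k0 kd.
  by rewrite nth_cat ifT //; lia.
do 2!split=> //; first by lia.
by move=> k k0 kd; rewrite nth_cat ifT; [exact: H|lia].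
Qed.

Lemma rjump_insn : rjump_ok p v d -> rjump (c n p) v d = rcons (rjump p v d) n.+1.
Proof.
move=> [vp [dl _]]; rewrite (ins_rcons pn) /rjump -cats1 index_cat vp.
have ip : index v p < size p by rewrite index_mem.
rewrite take_cat ip drop_cat drop_cat -!cats1.
have E i : i <= size p -> (if i < size p then drop i p ++ [:: n.+1] else drop (i - size p) [:: n.+1])
   = drop i p ++ [:: n.+1].
  by rewrite leq_eqVlt => /orP[/eqP->|->//]; rewrite ltnn subnn drop_size.
rewrite !E // take_cat size_drop -!catA.
case: ltnP => // H; have -> : d = size p - (index v p).+1 by lia.
by rewrite subnn take0 cats0 -size_drop take_size.
Qed.

Lemma ljump_ok_insn : ljump_ok (c n p) v d <-> ljump_ok p v d.
Proof.
rewrite (ins_rcons pn) /ljump_ok mem_rcons inE (ltn_eqF (_ : v < n.+1)) //=.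
split=> -[vp]; rewrite -cats1 index_cat vp => -[dl H]; do 2!split=> //; move=> k k0 kd.
  have := H k k0 kd; rewrite nth_cat ifT //.
  by have : index v p < size p; [rewrite index_mem|lia].
rewrite nth_cat ifT; first exact: H.
by have : index v p < size p; [rewrite index_mem|lia].
Qed.

Lemma ljump_insn : ljump_ok p v d -> ljump (c n p) v d = rcons (ljump p v d) n.+1.
Proof.
move=> [vp [dl _]]; rewrite (ins_rcons pn) /ljump -cats1 index_cat vp.
have ip : index v p < size p by rewrite index_mem.
have ip' : index v p - d < size p by lia.
rewrite take_cat ip' !drop_cat ip' -!cats1.
have -> : (if (index v p).+1 < size p then drop (index v p).+1 p ++ [:: n.+1] else drop ((index v p).+1 - size p) [:: n.+1])
   = drop (index v p).+1 p ++ [:: n.+1].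
  by move: ip; rewrite leq_eqVlt => /orP[/eqP->|->//]; rewrite ltnn subnn drop_size.
rewrite take_cat size_drop.
case: ltnP => H; first by rewrite -!catA /= -!catA.
have -> : d - (size p - (index v p - d)) = 0 by lia.
rewrite take0 cats0 [take d _]take_oversize ?size_drop // -!catA /= -!catA.
by [].
Qed.

End BoundaryInsertion.

(** * Jumps of the largest value *)

Section TopJump.
Variables (n k : nat) (p : seq nat).
Hypotheses (pn : is_perm n p) (kn : k <= n).

Lemma nth_ins_lt i : i <= n -> i != k -> nth 0 (c k p) i < n.+1.
Proof.
move=> i_n ik; have := is_perm_nth (is_perm_ins k pn) (i_n : i < n.+1) => -[_ le Ei].
rewrite ltn_neqAle le andbT; apply: contra ik => /eqP E.
by rewrite -Ei E (index_ins_top pn).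
Qed.

Lemma top_mem : n.+1 \in c k p.
Proof. by rewrite (is_perm_mem _ (is_perm_ins k pn)) leqnn. Qed.

Lemma rjump_ok_top d : rjump_ok (c k p) n.+1 d <-> k + d <= n.
Proof.
rewrite /rjump_ok top_mem (index_ins_top pn) // (is_perm_size (is_perm_ins k pn)) ltnS.
split=> [[_ []//]|kd]; do 2!split=> //; move=> i i0 id.
by apply: nth_ins_lt; lia.
Qed.

Lemma ljump_ok_top d : ljump_ok (c k p) n.+1 d <-> d <= k.
Proof.
rewrite /ljump_ok top_mem (index_ins_top pn) //.
split=> [[_ []//]|kd]; do 2!split=> //; move=> i i0 id.
by apply: nth_ins_lt; lia.
Qed.

Lemma rjump_top d : k + d <= n -> rjump (c k p) n.+1 d = c (k + d) p.
Proof.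
move=> kd; rewrite /rjump (index_ins_top pn) // /ins /= (is_perm_size pn).
have sk : size (take k p) = k by rewrite size_takel ?(is_perm_size pn).
rewrite -{1}sk take_size_cat // -addnS !drop_cat sk !ltnNge leqnSn leq_addr /= subSnn addKn /= drop0.
by rewrite catA -takeD drop_drop addnC.
Qed.

Lemma ljump_top d : d <= k -> ljump (c k p) n.+1 d = c (k - d) p.
Proof.
move=> dk; rewrite /ljump (index_ins_top pn) // /ins /= (is_perm_size pn).
have sk : size (take k p) = k by rewrite size_takel ?(is_perm_size pn).
have Ed : drop k.+1 (take k p ++ n.+1 :: drop k p) = drop k p.
  by rewrite drop_cat sk ltnNge leqnSn /= subSnn /= drop0.
rewrite Ed; congr (_ ++ _).
  rewrite take_cat sk; case: ltnP => H; first by rewrite take_takel ?leq_subr.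
  have -> : k - d = k by lia.
  by rewrite subnn take0 cats0.
congr (_ :: _); rewrite -[in RHS](cat_take_drop k p) !drop_cat sk.
case: ltnP => H.
  rewrite take_cat size_drop sk ifN; last by lia.
  have -> : d - (k - (k - d)) = 0 by lia.
  by rewrite take0 cats0.
have -> : d = 0 by lia.
by rewrite subn0 subnn take0 drop0.
Qed.

End TopJump.

(** * Algorithm J *)

Section BoundaryJumps.
Variables (n x : nat) (p : seq nat) (v : nat).
Hypotheses (xb : x = 0 \/ x = n) (pn : is_perm n p) (vn : v <= n).
Variables (L L' : seq nat -> Prop).
Hypothesis LL' : forall q, is_perm n q -> L (c x q) <-> L' q.

(** At an end, [n.+1] neither enables nor blocks jumps of smaller values. Shorter jumps than an
    admissible one are admissible as well, so their failure to land in [L] or in [L'] is the same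
    condition. *)
Lemma min_rjump_boundary t : min_rjump L (c x p) v t <->
  exists q, [/\ is_perm n q, t = c x q & min_rjump L' p v q].
Proof.
have Hok d : rjump_ok (c x p) v d <-> rjump_ok p v d.
  by case: xb => ->; [exact: (rjump_ok_ins0 _ pn vn)|exact: (rjump_ok_insn _ pn vn)].
have HE d : rjump_ok p v d -> rjump (c x p) v d = c x (rjump p v d).
  move=> ok; have qn := is_perm_rjump pn ok.
  case: xb => ->; first by rewrite (ins_cons qn) (rjump_ins0 d pn vn).
  by rewrite (ins_rcons qn) (rjump_insn pn vn ok).
have Hlt d d' : d' < d -> rjump_ok p v d -> rjump_ok p v d'.
  by move=> dd [vp [dl H]]; do 2!split=> //; [lia|move=> k k0 kd; apply: H; lia].
split=> [[d [d0 /Hok ok -> Lt H]]|[q [qn -> [d [d0 ok Eq Lq H]]]]].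
  have qn := is_perm_rjump pn ok.
  exists (rjump p v d); rewrite HE //; split=> //; exists d; split=> //.
    by apply/LL' => //; rewrite -HE.
  move=> d' d'0 dd; have ok' := Hlt _ _ dd ok.
  by rewrite -LL' -?HE //; [exact: H|exact: is_perm_rjump].
exists d; split=> //; first exact/Hok.
- by rewrite HE // Eq.
- exact/LL'.
move=> d' d'0 dd; have ok' := Hlt _ _ dd ok.
by rewrite HE // LL'; [exact: H|exact: is_perm_rjump].
Qed.

Lemma min_ljump_boundary t : min_ljump L (c x p) v t <->
  exists q, [/\ is_perm n q, t = c x q & min_ljump L' p v q].
Proof.
have Hok d : ljump_ok (c x p) v d <-> ljump_ok p v d.
  by case: xb => ->; [exact: (ljump_ok_ins0 _ pn vn)|exact: (ljump_ok_insn _ pn vn)].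
have HE d : ljump_ok p v d -> ljump (c x p) v d = c x (ljump p v d).
  move=> ok; have qn := is_perm_ljump pn ok.
  case: xb => ->; first by rewrite (ins_cons qn) (ljump_ins0 pn vn ok).
  by rewrite (ins_rcons qn) (ljump_insn pn vn ok).
have Hlt d d' : d' < d -> ljump_ok p v d -> ljump_ok p v d'.
  by move=> dd [vp [dl H]]; do 2!split=> //; [lia|move=> k k0 kd; apply: H; lia].
split=> [[d [d0 /Hok ok -> Lt H]]|[q [qn -> [d [d0 ok Eq Lq H]]]]].
  have qn := is_perm_ljump pn ok.
  exists (ljump p v d); rewrite HE //; split=> //; exists d; split=> //.
    by apply/LL' => //; rewrite -HE.
  move=> d' d'0 dd; have ok' := Hlt _ _ dd ok.
  by rewrite -LL' -?HE //; [exact: H|exact: is_perm_ljump].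
exists d; split=> //; first exact/Hok.
- by rewrite HE // Eq.
- exact/LL'.
move=> d' d'0 dd; have ok' := Hlt _ _ dd ok.
by rewrite HE // LL'; [exact: H|exact: is_perm_ljump].
Qed.

End BoundaryJumps.

Lemma min_rjump_top n k p L t : is_perm n p -> k <= n -> min_rjump L (c k p) n.+1 t ->
  exists j, [/\ k < j, j <= n, t = c j p & L (c j p)].
Proof.
move=> pn kn [d [d0 /(rjump_ok_top pn kn) kd -> + _]].
by rewrite (rjump_top pn) // => H; exists (k + d); split=> //; lia.
Qed.

Lemma min_ljump_top n k p L t : is_perm n p -> k <= n -> min_ljump L (c k p) n.+1 t ->
  exists j, [/\ j < k, j <= n, t = c j p & L (c j p)].
Proof.
move=> pn kn [d [d0 /(ljump_ok_top pn kn) kd -> + _]].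
by rewrite (ljump_top pn) // => H; exists (k - d); split=> //; lia.
Qed.

(** With the fibre of [p] exhausted, [n.+1] has no candidate, and the smaller values meet the same
    minimal jumps and the same visited permutations as in the run for [L']. *)
Lemma J_next_boundary n x L L' (vis vis' : seq (seq nat)) p q :
  x = 0 \/ x = n -> is_perm n p ->
  (forall r, is_perm n r -> L (c x r) <-> L' r) ->
  (forall r, is_perm n r -> L' r -> (c x r \in vis) = (r \in vis')) ->
  (forall k, k <= n -> L (c k p) -> c k p \in vis) ->
  J_next L' n vis' p q -> J_next L n.+1 vis (c x p) (c x q).
Proof.
move=> xb pn LL' Hvis Htop [v [v2 vn Hw [Hq qvis] Hboth]].
have xn : x <= n by case: xb => ->.
have Rb w (wn : w <= n) := min_rjump_boundary xb pn wn LL'.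
have Lb w (wn : w <= n) := min_ljump_boundary xb pn wn LL'.
have LR s w t : min_rjump L' s w t -> L' t by case=> d [].
have LLj s w t : min_ljump L' s w t -> L' t by case=> d [].
exists v; split=> //; first exact: leqW.
- move=> w vw; rewrite leq_eqVlt => /orP[/eqP->|wn].
    move=> [t [[/(min_rjump_top pn xn)|/(min_ljump_top pn xn)][j [_ jn -> Lj]]]];
    by rewrite Htop.
  rewrite ltnS in wn; move=> [t [H tvis]]; apply: (Hw w vw wn).
  case: H => [/(Rb _ wn)|/(Lb _ wn)][r [rn Et Hr]]; exists r; (split; first by [left|right]).
    by rewrite -Hvis -?Et //; exact: LR Hr.
  by rewrite -Hvis -?Et //; exact: LLj Hr.
- have qn : is_perm n q.
    case: Hq => [[d [_ ok -> _ _]]|[d [_ ok -> _ _]]].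
      exact: is_perm_rjump ok.
    exact: is_perm_ljump ok.
  split; first by case: Hq => Hq; [left; apply/(Rb _ vn)|right; apply/(Lb _ vn)]; exists q.
  by rewrite Hvis //; case: Hq => [/LR|/LLj].
- move=> [tr [tl [/(Rb _ vn)[r [rn Er Hr]] vr /(Lb _ vn)[l [ln El Hl]] vl]]].
  apply: Hboth; exists r, l; split=> //.
    by rewrite -Hvis -?Er //; exact: LR Hr.
  by rewrite -Hvis -?El //; exact: LLj Hl.
Qed.

(** The direction of a sweep through a fibre: for [true] the position of the largest value
    increases, so the sweep descends in the weak order. *)
Definition dir (d : bool) : rel nat := fun j k => if d then j < k else k < j.
Arguments dir !d j k /.

Lemma dir_trans d : transitive (dir d).
Proof. by case: d => y x z /=; lia. Qed.

Lemma dirxx d j : dir d j j = false.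
Proof. by case: d => /=; rewrite ltnn. Qed.

(** The value [n.+1] is considered first, so only a tie between its two directions could stop the
    step; there is none, as everything behind [k] has been visited. *)
Lemma J_next_top n d L (vis : seq (seq nat)) k k' p : is_perm n p -> k <= n -> k' <= n ->
  dir d k k' -> L (c k' p) -> c k' p \notin vis ->
  (forall j, dir d k j -> dir d j k' -> ~ L (c j p)) ->
  (forall j, j <= n -> dir d j k -> L (c j p) -> c j p \in vis) ->
  J_next L n.+1 vis (c k p) (c k' p).
Proof.
move=> pn kn kn' kk Lk' vk' Hmid Hvis; exists n.+1; split=> //.
- by case: d kk {Hmid Hvis} => /=; lia.
- by move=> w; lia.
- split=> //; case: d kk Hmid {Hvis} => /= kk Hmid; [left; exists (k' - k)|right; exists (k - k')].
    have E : k + (k' - k) = k' by lia.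
    split; [lia|apply/(rjump_ok_top pn) => //; lia|by rewrite (rjump_top pn) ?E //; lia|by []|].
    by move=> d' d0 dd; rewrite (rjump_top pn) //; [apply: Hmid; lia|lia].
  have E : k - (k - k') = k' by lia.
  split; [lia|apply/(ljump_ok_top pn) => //; lia|by rewrite (ljump_top pn) ?E //; lia|by []|].
  by move=> d' d0 dd; rewrite (ljump_top pn) //; [apply: Hmid; lia|lia].
move=> [tr [tl [/(min_rjump_top pn kn)[i [ki i_n -> Li]] vi /(min_ljump_top pn kn)[j [jk jn -> Lj]] vj]]].
case: d Hvis {kk Hmid} => /= Hvis.
  by rewrite Hvis in vj.
by rewrite Hvis in vi.
Qed.

Lemma fibred_adjacent n e R R' p k k' : lattice_congruence n.+1 e -> fibred n e R R' ->
  R' p -> k' < k -> k <= n -> R (c k p) -> R (c k' p) ->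
  (forall j, k' < j -> j < k -> ~ R (c j p)) ->
  adjacent_classes n.+1 e (c k p) (c k' p).
Proof.
move=> ce [P HR Hu _] R'p kk kn Rk Rk' Hmid; have [er es et _ _] := ce.
have pn := P p R'p; have Pn j : is_perm n.+1 (c j p) by exact: is_perm_ins.
have kn' : k' <= n by lia.
have nk : ~ e (c k p) (c k' p).
  have [i [_ Hi]] := Hu p k R'p kn => ekk.
  have : k = k' by rewrite -(Hi k) ?(Hi k') //; split=> //; exact: er.
  by lia.
(* The representative of [c j p] is not strictly between the two ends, so by convexity [c j p] is
   equivalent to the end that separates it from its representative. *)
have cover j : k' <= j -> j <= k -> e (c j p) (c k p) \/ e (c j p) (c k' p).
  move=> kj jk; have jn : j <= n by lia.
  have [i [[i_n Ri eij] _]] := Hu p j R'p jn.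
  have [ki|ik] := leqP k i.
    left; apply: (et _ (c i p)) => //; apply: (cong_convex ce (z := c j p)) => //;
      try (by apply: (wle_ins_id pn)); exact: es.
  have [ki'|ik'] := leqP i k'; last by case: (Hmid i ik' ik Ri).
  right; apply: (cong_convex ce (z := c i p)) => //; exact: (wle_ins_id pn).
have exP : exists j, (k' <= j) && `[< e (c j p) (c k p) >].
  by exists k; rewrite ltnW //; apply/asboolP/er.
(* The class changes just before the least position [m] equivalent to [k], and the step from [m] to
   [m.-1] adds a single inversion. *)
case: (ex_minnP exP) => m /andP[km /asboolP em] Hm.
have mk : m <= k by apply: Hm; rewrite ltnW //; apply/asboolP/er.
have mk' : m != k' by apply/eqP => E; apply: nk; apply: es => //; rewrite -E.
case: m km em Hm mk mk' => [|m] km em Hm mk mk'; first by lia.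
split=> //; exists (c m.+1 p), (c m p); split=> //.
- exact: es.
- apply: es => //; case: (cover m) => //; [lia|lia|move=> em'].
  suff : m < m by rewrite ltnn.
  by apply: Hm; apply/andP; split; [lia|exact/asboolP].
by apply: (wcov_ins pn); lia.
Qed.

(** A run in recursive form, suited to concatenation: [vis] stands for everything visited up to and
    including [s], and [r] is the continuation. *)
Fixpoint visits (step : seq (seq nat) -> seq nat -> seq nat -> Prop) vis s r : Prop :=
  if r is t :: r' then step vis s t /\ visits step (rcons vis t) t r' else True.

Lemma visits_cat step vis s r1 r2 :
  visits step vis s r1 -> visits step (vis ++ r1) (last s r1) r2 ->
  visits step vis s (r1 ++ r2).
Proof.
elim: r1 vis s => [|t r1 IH] vis s /=; first by rewrite cats0.
by move=> [st H1] H2; split=> //; apply: IH => //; rewrite cat_rcons.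
Qed.

Lemma visits_nth step vis s r j : visits step vis s r -> j < size r ->
  step (vis ++ take j r) (nth [::] (s :: r) j) (nth [::] r j).
Proof.
elim: r vis s j => [|t r IH] vis s [|j] //= [st H]; first by rewrite cats0.
by rewrite ltnS => /(IH _ _ _ H); rewrite cat_rcons.
Qed.

Lemma visits_uniq step vis s r : (forall vis s t, step vis s t -> t \notin vis) ->
  visits step vis s r -> uniq vis -> uniq (vis ++ r).
Proof.
move=> Hs; elim: r vis s => [|t r IH] vis s /=; first by rewrite cats0.
by move=> [/Hs tv /IH]; rewrite rcons_uniq tv /= cat_rcons; exact.
Qed.

(** * Alternating sweeps through the fibres *)

Definition hamilton_step n e R vis s t : Prop :=
  J_next R n vis s t /\ (adjacent_classes n e s t \/ adjacent_classes n e t s).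

Definition fibre_positions n (R : seq nat -> Prop) (d : bool) p : seq nat :=
  let ks := [seq k <- iota 0 n.+1 | `[< R (c k p) >]] in if d then ks else rev ks.

Fixpoint weave n R d (r : seq (seq nat)) : seq (seq nat) :=
  if r is p :: r' then [seq c k p | k <- fibre_positions n R d p] ++ weave n R (~~ d) r'
  else [::].

Lemma mem_fibre_positions n R d p k :
  (k \in fibre_positions n R d p) = (k <= n) && `[< R (c k p) >].
Proof.
rewrite /fibre_positions; case: d; rewrite ?mem_rev mem_filter mem_iota /= add0n ltnS;
by rewrite andbC.
Qed.

Lemma mem_weave n R d r s :
  s \in weave n R d r <-> exists p k, [/\ p \in r, k <= n, s = c k p & R s].
Proof.
elim: r d => [|p r IH] d /=; first by split=> // -[? [? []]].
rewrite mem_cat; split.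
  case/orP => [/mapP[k]|/IH[q [k [qr kn Es Rs]]]].
    rewrite mem_fibre_positions => /andP[kn /asboolP Rk ->].
    by exists p, k; rewrite mem_head.
  by exists q, k; rewrite inE qr orbT.
move=> [q [k [+ kn Es Rs]]]; rewrite inE => /orP[/eqP Eq|qr]; apply/orP.
  left; apply/mapP; exists k; last by rewrite Es Eq.
  by rewrite mem_fibre_positions kn; apply/asboolP; rewrite -Eq -Es.
by right; apply/IH; exists q, k.
Qed.

(** The invariant is that [ks] lists the chosen positions ahead of [k], while the visited part of
    the fibre consists of the chosen positions not ahead of [k]. *)
Lemma visits_fibre n e R R' d p k ks vis : lattice_congruence n.+1 e -> fibred n e R R' ->
  R' p -> k <= n -> R (c k p) -> path (dir d) k ks ->
  (forall j, dir d k j -> (j \in ks) = (j <= n) && `[< R (c j p) >]) ->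
  (forall j, j <= n -> R (c j p) -> (c j p \in vis) = ~~ dir d k j) ->
  visits (hamilton_step n.+1 e R) vis (c k p) [seq c j p | j <- ks].
Proof.
move=> ce fR R'p; have pn : is_perm n p by case: fR => P _ _ _; exact: P.
elim: ks k vis => [//|k' ks IH] k vis kn Rk /[dup] kks /= /andP[kk' k'ks] Hks Hvis.
have [kn' Rk'] : k' <= n /\ R (c k' p).
  by have := Hks k' kk'; rewrite mem_head => /esym/andP[? /asboolP].
have min_k' j : j \in ks -> dir d k' j.
  by have /allP := order_path_min (@dir_trans d) k'ks; exact.
have Hmid j : dir d k j -> dir d j k' -> ~ R (c j p).
  move=> kj jk Rj; have jn : j <= n by case: (d) kj jk => /=; lia.
  have := Hks j kj; rewrite jn asboolT // inE => /orP[/eqP E|/min_k' k'j].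
    by rewrite E dirxx in jk.
  by have := dir_trans jk k'j; rewrite dirxx.
split.
  split.
    apply: (J_next_top pn kn kn' kk' Rk') => //; first by rewrite Hvis // kk'.
    move=> j jn jk Rj; rewrite Hvis //; apply/negP => kj.
    by have := dir_trans jk kj; rewrite dirxx.
  case: d kk' Hmid {IH kks k'ks Hks Hvis min_k'} => /= kk' Hmid.
    right; apply: (fibred_adjacent ce fR) => //.
  left; apply: (fibred_adjacent ce fR) => // j j1 j2; exact: Hmid.
apply: IH => // j.
  move=> k'j; have := Hks j (dir_trans kk' k'j); rewrite inE => <-.
  by case: eqP k'j => // ->; rewrite dirxx.
move=> jn Rj; rewrite mem_rcons inE Hvis //.
have -> : (c j p == c k' p) = (j == k').
  by apply/eqP/eqP => [/(ins_inj pn pn jn kn')[]|->].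
case: eqP => [->|jk']; first by rewrite dirxx.
case kj: (dir d k j) => /=.
  have := Hks j kj; rewrite jn asboolT // inE => /orP[/eqP//|/min_k' ->//].
by apply/esym/negP => k'j; have := dir_trans kk' k'j; rewrite kj.
Qed.

Lemma J_next_mem L n vis s t : J_next L n vis s t -> L t /\ t \notin vis.
Proof. by case=> v [_ _ _ [[[d []]|[d []]] ? ?]]. Qed.

(** A sweep in direction [d] starts at [x d] and ends at [x (~~ d)], where the opposite sweep of the
    next fibre starts. The hypotheses on [vis] say that fibres left behind are exhausted and the
    current one is visited only at its start. *)
Lemma visits_weave n e R R' (x : bool -> nat) : lattice_congruence n.+1 e -> fibred n e R R' ->
  (forall d, x d = 0 \/ x d = n) ->
  (forall d p, R' p -> exists ks, [/\ fibre_positions n R d p = x d :: ks,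
      path (dir d) (x d) ks & last (x d) ks = x (~~ d)]) ->
  forall r d p (vis vis' : seq (seq nat)), R' p -> p \in vis' ->
  (forall q, R' q -> q != p -> forall k, k <= n -> R (c k q) -> (c k q \in vis) = (q \in vis')) ->
  (forall k, k <= n -> R (c k p) -> (c k p \in vis) = (k == x d)) ->
  visits (hamilton_step n (restr e) R') vis' p r ->
  visits (hamilton_step n.+1 e R) vis (c (x d) p)
     ([seq c k p | k <- behead (fibre_positions n R d p)] ++ weave n R (~~ d) r).
Proof.
move=> ce fR xb Hx; have [P HR Hu _] := fR.
have xn d : x d <= n by case: (xb d) => ->.
have Rx d p : R' p -> R (c (x d) p).
  move=> R'p; have [ks [E _ _]] := Hx d p R'p.
  by have := mem_fibre_positions n R d p (x d); rewrite E mem_head => /esym/andP[_ /asboolP].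
have RR' d p : is_perm n p -> R (c (x d) p) <-> R' p.
  move=> pn; split; last exact: Rx.
  by move=> /HR[k [q [kn R'q]]] /(ins_inj pn (P q R'q) (xn d) kn)[_ ->].
elim=> [|q r IH] d p vis vis' R'p pvis Hvis Hvisp Hr;
  have pn := P p R'p; have [ks [E pks lks]] := Hx d p R'p; rewrite E /=.
  all: have memks j : j <= n -> R (c j p) -> j \in x d :: ks
    by move=> jn Rj; rewrite -E mem_fibre_positions jn asboolT.
  all: have V : visits (hamilton_step n.+1 e R) vis (c (x d) p) [seq c k p | k <- ks].
  1,3: apply: (visits_fibre ce fR R'p (xn d) (Rx d p R'p) pks) => [j xj|j jn Rj];
    [ have := mem_fibre_positions n R d p j; rewrite E inE => <-;
      by case: eqP xj => // ->; rewrite dirxx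
    | rewrite Hvisp //; have := memks j jn Rj; rewrite inE;
      case: eqP => [->|_] /=; [by rewrite dirxx|];
      by have /allP H := order_path_min (@dir_trans d) pks; move/H => -> ].
  by rewrite cats0.
apply: visits_cat => //; rewrite (last_map (fun k => c k p)) lks.
set vis1 := vis ++ _.
(* After the sweep of [p], a chosen permutation is visited exactly if its deletion is. *)
have Hvis1 s k : R' s -> k <= n -> R (c k s) -> (c k s \in vis1) = (s \in vis').
  move=> R's kn Rk; rewrite mem_cat; have sn := P s R's.
  have [sp|sp] := eqVneq s p.
    subst s; rewrite pvis Hvisp //; have := memks k kn Rk; rewrite inE.
    by case: eqP => //= _ H; apply/mapP; exists k.
  rewrite Hvis //; case: (s \in vis') => //=; apply/negP => /mapP[j jks].
  have jn : j <= n.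
    by have := mem_fibre_positions n R d p j; rewrite E inE jks orbT => /esym/andP[].
  by move=> /(ins_inj sn pn kn jn)[_ Esp]; rewrite Esp eqxx in sp.
case: Hr => -[Jpq adj] Hr; have [R'q qvis] := J_next_mem Jpq; have qn := P q R'q.
have [ks' [E' _ _]] := Hx (~~ d) q R'q; move: (IH (~~ d) q); rewrite E' /= => {}IH.
split.
  split.
    apply: (J_next_boundary (xb _) pn (RR' _) _ _ Jpq) => [s sn R's|k kn Rk].
      by apply: Hvis1 => //; exact: Rx.
    by rewrite Hvis1.
  have lift s t : R' s -> R' t -> adjacent_classes n (restr e) s t ->
      adjacent_classes n.+1 e (c (x (~~ d)) s) (c (x (~~ d)) t).
    move=> /P sn /P tn H; case: (xb (~~ d)) => ->.
      exact: adjacent_classes_ins0.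
    exact: adjacent_classes_insn.
  by case: adj => H; [left|right]; exact: lift.
apply: IH Hr => //.
- by rewrite mem_rcons mem_head.
- move=> s R's sq k kn Rk; rewrite !mem_rcons !inE (negPf sq) /= Hvis1 //.
  case: eqP => // /(ins_inj (P s R's) qn kn (xn _))[_ Esq].
  by rewrite Esq eqxx in sq.
move=> k kn Rk; rewrite mem_rcons inE Hvis1 // (negPf qvis) orbF.
by apply/eqP/eqP => [/(ins_inj qn qn kn (xn _))[]|->].
Qed.

Lemma fibre_positions_all n R p : R (c 0 p) -> R (c n p) ->
  exists ks l, [/\ fibre_positions n R true p = 0 :: ks, fibre_positions n R true p = rcons l n
    & sorted ltn (0 :: ks)].
Proof.
move=> R0 Rn; pose P k := `[< R (c k p) >].
exists [seq k <- iota 1 n | P k], [seq k <- iota 0 n | P k]; split.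
- by rewrite /fibre_positions /= asboolT.
- rewrite /fibre_positions -[X in iota _ X]addn1 iotaD add0n cats1 filter_rcons.
  by rewrite asboolT.
have -> : 0 :: [seq k <- iota 1 n | P k] = [seq k <- iota 0 n.+1 | P k].
  by rewrite /= /P asboolT.
by apply: sorted_filter; [exact: ltn_trans|exact: iota_ltn_sorted].
Qed.

(** If both ends of each fibre are chosen, a sweep starts at [0] or [n] according to its direction.
    Otherwise each fibre contributes [c n p] alone, and both ends of a sweep are [n]. *)
Lemma fibred_positions n e R R' : fibred n e R R' ->
  exists x : bool -> nat, [/\ x false = n, forall d, x d = 0 \/ x d = n &
  forall d p, R' p -> exists ks, [/\ fibre_positions n R d p = x d :: ks,
      path (dir d) (x d) ks & last (x d) ks = x (~~ d)]].
Proof.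
move=> [P HR Hu [H|H]].
  exists (fun d => if d then 0 else n); split=> //; first by case; [left|right].
  move=> d p R'p; have [R0 Rn] := H p R'p.
  have [ks [l [E1 E2 sks]]] := fibre_positions_all R0 Rn.
  case: d; first exists ks.
    split=> //; have : last 0 (0 :: ks) = n by rewrite -E1 E2 last_rcons.
    by [].
  have E : fibre_positions n R false p = rev (fibre_positions n R true p) by [].
  exists (rev l); split; first by rewrite E E2 rev_rcons.
    by rewrite -[path _ _ _]/(sorted gtn (n :: rev l)) -rev_rcons -E2 E1 rev_sorted.
  by rewrite -[last _ _]/(last n (n :: rev l)) -rev_rcons -E2 E1 rev_cons last_rcons.
exists (fun=> n); split=> //; first by right.
move=> d p R'p; exists [::]; split=> //; have pn := P p R'p.
have E : fibre_positions n R true p = [:: n].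
  rewrite /fibre_positions -[X in iota _ X]addn1 iotaD add0n cats1 filter_rcons.
  rewrite asboolT; last by apply/H; exists p.
  rewrite (@eq_in_filter _ _ pred0) ?filter_pred0 // => k; rewrite mem_iota /= add0n => kn.
  apply/asboolP => /H[q [R'q /(ins_inj pn (P q R'q) (ltnW kn) (leqnn n))[Ek _]]].
  by rewrite Ek ltnn in kn.
by case: d; [exact: E|rewrite -[LHS]/(rev (fibre_positions n R true p)) E].
Qed.

Lemma isR_visits n e R : lattice_congruence n e -> isR n e R ->
  exists r, (forall s, R s <-> s \in idp n :: r) /\
    visits (hamilton_step n e R) [:: idp n] (idp n) r.
Proof.
elim: n e R => [|n IH] e R ce.
  by move=> HR; exists [::]; split=> // s; rewrite inE; split=> [/HR->//|/eqP->]; exact/HR.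
move=> /(isR_fibred ce)[R' [HR' fR]].
have [r' [Hr' Vr']] := IH _ _ (cong_restr ce) HR'.
have [P HR _ _] := fR; have [x [xf xb Hx]] := fibred_positions fR.
have R'id : R' (idp n) by apply/Hr'; exact: mem_head.
have idn := is_perm_idp n.
(* The first sweep has direction [false], since the identity is [c n (idp n)]; its start is split
   off by [behead]. *)
exists ([seq c k (idp n) | k <- behead (fibre_positions n R false (idp n))] ++ weave n R true r').
have Ew : idp n.+1 :: [seq c k (idp n) | k <- behead (fibre_positions n R false (idp n))]
    ++ weave n R true r' = weave n R false (idp n :: r').
  rewrite -[RHS]/([seq c k (idp n) | k <- fibre_positions n R false (idp n)] ++ weave n R true r').
  by have [ks [E _ _]] := Hx false _ R'id; rewrite E /= xf idp_ins.
split.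
  move=> s; rewrite Ew; split=> [Rs|/mem_weave[p [k []]]//].
  by have [k [p [kn /Hr' pr Es]]] := HR s Rs; apply/mem_weave; exists p, k.
rewrite idp_ins; have := visits_weave ce fR xb Hx (d := false) (vis := [:: c n (idp n)]) R'id _ _ _ Vr'.
rewrite xf; apply.
- exact: mem_head.
- move=> q R'q qid k kn Rk; rewrite !inE (negPf qid); apply/eqP.
  by move=> /(ins_inj (P q R'q) idn kn (leqnn n))[_ E]; rewrite E eqxx in qid.
move=> k kn Rk; rewrite inE.
by apply/eqP/eqP => [/(ins_inj idn idn kn (leqnn n))[]|->].
Qed.

Theorem mainTheorem1 (n : nat) (e : seq nat -> seq nat -> Prop) :
  1 <= n -> lattice_congruence n e ->
  (exists R, isR n e R) /\
  forall R, isR n e R ->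
    [/\ (forall s, R s -> is_perm n s),
        (forall sigma, is_perm n sigma -> exists! rho, R rho /\ e sigma rho),
        zigzag n R &
        exists run, [/\ J_run R n (idp n) run, uniq run,
          (forall s, R s <-> s \in run),
          (forall j, j.+1 < size run ->
             qedge n e (nth [::] run j) (nth [::] run j.+1)) &
          (forall sigma, is_perm n sigma ->
             exists! j, j < size run /\ e sigma (nth [::] run j))]].
Proof.
move=> _ ce; split; first exact: isR_ex.
move=> R HR; have RP s : R s -> is_perm n s by exact: isR_is_perm HR.
have reps := isR_representatives ce HR.
split=> //; first exact: isR_zigzag HR.
have [r [Rr Vr]] := isR_visits ce HR.
have ur : uniq (idp n :: r).
  apply: (visits_uniq (vis := [:: idp n]) _ Vr) => // vis s t [].
  by move=> /J_next_mem[].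
have Hstep j (jr : j.+1 < size (idp n :: r)) := visits_nth Vr (jr : j < size r).
exists (idp n :: r); split=> //.
- split=> //; first by move=> j /Hstep[].
  (* A further step would reach an unvisited member of [R], but the run contains them all. *)
  by move=> [t /J_next_mem[/Rr ->]].
- move=> j jr; have [_ adj] := Hstep j jr.
  have Pj i : i < size (idp n :: r) -> is_perm n (nth [::] (idp n :: r) i).
    by move=> ir; apply/RP/Rr/mem_nth.
  have P1 := Pj _ (ltnW jr); have P2 := Pj _ jr.
  by case: adj => H; [left|right]; exact: adjacent_classes_qcover H.
move=> s sn; have [t [[/Rr tr est] Ht]] := reps s sn.
exists (index t (idp n :: r)); split; first by rewrite index_mem nth_index.
move=> j [jr ej]; rewrite (Ht (nth [::] (idp n :: r) j)) ?index_uniq //.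
by split=> //; apply/Rr/mem_nth.
Qed.
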